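(* Let $\gamma\ge1$, $k=\sqrt2$, $\mu>0$, $s\in\mathbb{R}$, and let $(R,U)$ be a traveling wave profile with speed $s$. Suppose $\mu<2$. Let $\epsilon_\pm=\epsilon_\pm(\lambda)$ be the explicit quantities defined in the context. Then there is a constant $C>0$ such that $$\sqrt2\,\sqrt{\epsilon_+^2+\epsilon_-^2}<1\quad\text{for all }\lambda\in\mathbb{C}\text{ with }\Re(\lambda)\ge0\text{ and }|\lambda|\ge C.$$ As a consequence of this inequality, the Evans function $E(\lambda)$ for the scalar equation (with $k^2=2$) $$\hat\rho^{(4)}+2\Bigl(\frac{s\mu}{k^2}-\frac{R'}{R}\Bigr)\hat\rho'''+\frac{2}{k^2}\bigl(R(f_1+f_4+2\mu f_6'+g_4)+(s-U)(f_2+g_2)-\lambda\mu\bigr)\hat\rho''$$ $$+\frac{2}{k^2}\Bigl(R(f_1'+f_3+(f_2+g_2)f_6'+\mu f_6''+g_3)+(s-U)(f_2'+g_1)+\lambda\bigl(2(U-s)+\mu\tfrac{R'}{R}\bigr)\Bigr)\hat\rho'$$ $$+\frac{2}{k^2}\Bigl(\lambda\bigl(-f_2'-g_1+(f_2+g_2)\tfrac{R'}{R}-\mu R(R^{-1})''\bigr)+\lambda^2\Bigr)\hat\rho=0\qquad(\mathrm E)$$ has no zeros in the region $\{\Re(\lambda)\ge0,\ |\lambda|\ge C\}$.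
   Context: Throughout $k=\sqrt2$. Enthalpy: $h(\rho)=\ln\rho$ if $\gamma=1$, $h(\rho)=\frac{\gamma}{\gamma-1}\rho^{\gamma-1}$ if $\gamma>1$. Profile: a traveling wave profile with speed $s$ is a pair of smooth functions $R>0$, $U$ on $\mathbb{R}$ with limits $R(x)\to R^\pm>0$, $U(x)\to U^\pm$ as $x\to\pm\infty$, all of whose derivatives tend to $0$ at $\pm\infty$, satisfying $-sR'+(RU)'=0$ and $-sU'+\bigl(\tfrac{U^2}{2}\bigr)'+(h(R))'=\mu\bigl(\tfrac{(RU)'}{R}\bigr)'+k^2\bigl(\tfrac{(\sqrt R)''}{\sqrt R}\bigr)'$. Functions of $x$ associated with the profile ($'=d/dx$): $f_1=-h'(R)$ (the derivative $\frac{dh}{dR}$ evaluated at $R(x)$; $f_1'$ is the $x$-derivative), $f_2=s-U$, $f_3=\frac{k^2}{2}\bigl((R^{-1/2}(R^{-1/2})'')'-(R^{-3/2}(R^{1/2})'')'\bigr)$, $f_4=\frac{k^2}{2}\bigl(R^{-1/2}(R^{-1/2})''+2(R^{-1/2}(R^{-1/2})')'-R^{-3/2}(R^{1/2})''\bigr)$, $f_6=\frac{s-U}{R}$, $g_1=\mu\bigl(\frac{R'}{R}\bigr)'$, $g_2=\mu\frac{R'}{R}$, $g_3=\mu\Bigl(\bigl(\frac{U'}{R}\bigr)'-\bigl(\frac{(RU)'}{R^2}\bigr)'\Bigr)$, $g_4=\mu\Bigl(\frac{U'}{R}+\bigl(\frac{U}{R}\bigr)'-\frac{(RU)'}{R^2}\Bigr)$.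 Definition of $\epsilon_\pm$ (for $0<\mu<2$). Let $\theta_{1}=\mathrm{Arg}\bigl(\frac\mu2+ i\sqrt{1-\frac{\mu^2}{4}}\bigr)\in(0,\pi/2)$ and $\theta_2=-\theta_1$. For $\lambda\ne0$ with $\Re\lambda\ge0$ write $\lambda/|\lambda|=e^{i\theta}$, $\theta\in[-\pi/2,\pi/2]$, and set $z_1=-e^{i(\theta+\theta_1)/2}$, $z_3=e^{i(\theta+\theta_1)/2}$, $z_2=-e^{i(\theta+\theta_2)/2}$, $z_4=e^{i(\theta+\theta_2)/2}$ (the distances $|z_j-z_k|$ do not depend on $\theta$). Let $m_1(\lambda)=|\lambda|^{-1}\sup_{x\ge0}\bigl|-f_2'-g_1+(f_2+g_2)\frac{R'}{R}-\mu R(R^{-1})''\bigr|$, $m_2(\lambda)=|\lambda|^{-3/2}\sup_{x\ge0}\bigl|R(f_1'+f_3+(f_2+g_2)f_6'+\mu f_6''+g_3)+(s-U)(f_2'+g_1)\bigr|+|\lambda|^{-1/2}\sup_{x\ge0}\bigl|2(U-s)+\mu\frac{R'}{R}\bigr|$, $m_3(\lambda)=|\lambda|^{-1}\sup_{x\ge0}\bigl|R(f_1+f_4+2\mu f_6'+g_4)+(s-U)(f_2+g_2)\bigr|$, $m_4(\lambda)=|\lambda|^{-1/2}\sup_{x\ge0}\bigl|s\mu-\frac{2R'}{R}\bigr|$. Set $p_k=\sum_{l=1}^4m_l(\lambda)$ for $k=1,\dots,4$, $q_j=\prod_{i\ne j}|z_j-z_i|$ for $j=1,\dots,4$, and let $\tilde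 B_+$ be the $4\times4$ matrix with entries $\tilde b_{j,k}=p_k/q_j$. The matrix $\tilde B_-$ is defined in the same way with the suprema in the $m_l(\lambda)$ taken over $x\le0$. Finally $\alpha=\Re\bigl(e^{i(\pi/2+\theta_1)/2}\bigr)=\cos\bigl(\frac\pi4+\frac{\theta_1}{2}\bigr)>0$ and $\epsilon_\pm=4\alpha^{-1}\|\tilde B_\pm\|_F$, where $\|A\|_F=\sqrt{\sum_{j,k}|a_{j,k}|^2}$. Evans function: write $(\mathrm E)$ as a first-order system $Y'=\tilde A(x,\lambda)Y$ for $Y=(\hat\rho,\hat\rho',\hat\rho'',\hat\rho''')^T$. For $\lambda$ such that each of the limit matrices at $x=\pm\infty$ has two eigenvalues with positive and two with negative real part, let $Y_1^-,Y_2^-$ be a basis of the solutions decaying as $x\to-\infty$ and $Y_1^+,Y_2^+$ a basis of the solutions decaying as $x\to+\infty$. The Evans function is $E(\lambda)=\det(Y_1^-(0),Y_2^-(0),Y_1^+(0),Y_2^+(0))$; whether it vanishes does not depend on the choice of bases. The assertion that $E$ has no zeros in a region includes that $E$ is defined there. *)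

(* Defs.v *)
From mathcomp Require Import all_boot all_order all_algebra.
From mathcomp Require Import complex.
From mathcomp Require Import all_classical all_reals all_analysis.

Set Implicit Arguments.
Unset Strict Implicit.
Unset Printing Implicit Defensive.

Import Order.TTheory GRing.Theory Num.Theory.
Import numFieldNormedType.Exports.
Import ComplexField.Normc.

Local Open Scope classical_set_scope.
Local Open Scope ring_scope.
Local Open Scope complex_scope.

(* Derivatives of functions, not of polynomials. *)
Local Notation "f ^` ()" := (derive1 f) : ring_scope.
Local Notation "f ^` ( n )" := (derive1n n f) : ring_scope.

(* MathComp-Analysis over an arbitrary realType R; the complex numbers are
   R[i], and [normc z : R] is the modulus of z. *)

Section ComplexValued.
Variable R : realType.
Implicit Types (z : R[i]) (t : R).

Definition expi t : R[i] := cos t +i* sin t.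

(* The principal value, in ]-pi, pi]; at z = 0 it is unspecified. *)
Definition Arg z : R :=
  xget 0 [set t | - pi < t <= pi /\ z = (normc z)%:C * expi t].

(* R[i] carries no topology in the libraries: limits and derivatives of
   complex-valued functions of a real variable are taken componentwise. *)
Definition ccvg (F : set_system R) (f : R -> R[i]) (l : R[i]) : Prop :=
  (complex.Re (f x) @[x --> F] --> complex.Re l) /\
  (complex.Im (f x) @[x --> F] --> complex.Im l).

Definition is_cderive (f : R -> R[i]) (x : R) (d : R[i]) : Prop :=
  is_derive x 1 (fun y => complex.Re (f y)) (complex.Re d) /\
  is_derive x 1 (fun y => complex.Im (f y)) (complex.Im d).

End ComplexValued.

Section Profile.
Variable R : realType.

Definition kcap : R := Num.sqrt 2.

Definition enthalpy (gamma rho : R) : R :=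
  if gamma == 1 then ln rho else gamma / (gamma - 1) * rho `^ (gamma - 1).

Definition smooth (f : R -> R) : Prop :=
  forall (n : nat) (x : R), derivable f^`(n) x 1.

Definition derivatives_vanish (f : R -> R) : Prop :=
  forall n : nat,
    (f^`(n.+1) x @[x --> +oo] --> 0) /\ (f^`(n.+1) x @[x --> -oo] --> 0).

(* Here and below [r], [u] are the density and velocity profiles R, U. *)
Definition traveling_wave (gamma mu s : R) (r u : R -> R) : Prop :=
  [/\ smooth r /\ smooth u,
      forall x, 0 < r x,
      (exists rp rm up um : R,
         [/\ 0 < rp /\ 0 < rm,
             r x @[x --> +oo] --> rp, r x @[x --> -oo] --> rm,
             u x @[x --> +oo] --> up & u x @[x --> -oo] --> um]),
      derivatives_vanish r /\ derivatives_vanish u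
    & forall x,
        - s * r^`() x + (fun y => r y * u y)^`() x = 0 /\
        - s * u^`() x + (fun y => u y ^+ 2 / 2)^`() x
          + (fun y => enthalpy gamma (r y))^`() x
        = mu * (fun y => (fun z => r z * u z)^`() y / r y)^`() x
          + kcap ^+ 2 * (fun y => (fun z => Num.sqrt (r z))^`(2) y
                                  / Num.sqrt (r y))^`() x].

End Profile.

Section Coefficients.
Variable R : realType.
Variables (gamma mu s : R) (r u : R -> R).

Local Notation k := (kcap R).
Local Notation rpow a := (fun x : R => r x `^ a).
Local Notation ru := (fun x : R => r x * u x).

Definition f1 (x : R) : R := - (enthalpy gamma)^`() (r x).
Definition f2 (x : R) : R := s - u x.
Definition f3 (x : R) : R := k ^+ 2 / 2 *
  ((fun y => rpow (- (1 / 2)) y * (rpow (- (1 / 2)))^`(2) y)^`() x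
   - (fun y => rpow (- (3 / 2)) y * (rpow (1 / 2))^`(2) y)^`() x).
Definition f4 (x : R) : R := k ^+ 2 / 2 *
  (rpow (- (1 / 2)) x * (rpow (- (1 / 2)))^`(2) x
   + 2 * (fun y => rpow (- (1 / 2)) y * (rpow (- (1 / 2)))^`() y)^`() x
   - rpow (- (3 / 2)) x * (rpow (1 / 2))^`(2) x).
Definition f6 (x : R) : R := (s - u x) / r x.
Definition g1 (x : R) : R := mu * (fun y => r^`() y / r y)^`() x.
Definition g2 (x : R) : R := mu * (r^`() x / r x).
Definition g3 (x : R) : R := mu *
  ((fun y => u^`() y / r y)^`() x - (fun y => ru^`() y / r y ^+ 2)^`() x).
Definition g4 (x : R) : R := mu *
  (u^`() x / r x + (fun y => u y / r y)^`() x - ru^`() x / r x ^+ 2).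

(* The groups of terms of (E); (E) and the m_l are both built from them. *)
Definition e0 (x : R) : R :=
  - f2^`() x - g1 x + (f2 x + g2 x) * (r^`() x / r x)
  - mu * r x * (fun y => (r y)^-1)^`(2) x.
Definition e1 (x : R) : R :=
  r x * (f1^`() x + f3 x + (f2 x + g2 x) * f6^`() x + mu * f6^`(2) x + g3 x)
  + (s - u x) * (f2^`() x + g1 x).
Definition e1' (x : R) : R := 2 * (u x - s) + mu * (r^`() x / r x).
Definition e2 (x : R) : R :=
  r x * (f1 x + f4 x + 2 * mu * f6^`() x + g4 x) + (s - u x) * (f2 x + g2 x).
Definition e3 (x : R) : R := s * mu - 2 * r^`() x / r x.

Section Epsilon.
Variables (D : set R) (lambda : R[i]).

Definition theta1 : R := Arg ((mu / 2) +i* Num.sqrt (1 - mu ^+ 2 / 4)).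
Definition theta2 : R := - theta1.

(* zroot 0, ..., zroot 3 are z_1, ..., z_4. *)
Definition zroot (j : 'I_4) : R[i] :=
  let theta := Arg lambda in
  nth 0 [:: - expi ((theta + theta1) / 2); - expi ((theta + theta2) / 2);
            expi ((theta + theta1) / 2); expi ((theta + theta2) / 2)] j.

(* The suprema below are of bounded sets for a traveling wave profile. *)
Definition supabs (f : R -> R) : R := sup [set `|f x| | x in D].

Definition m1 : R := (normc lambda)^-1 * supabs e0.
Definition m2 : R :=
  normc lambda `^ (- (3 / 2)) * supabs e1
  + normc lambda `^ (- (1 / 2)) * supabs e1'.
Definition m3 : R := (normc lambda)^-1 * supabs e2.
Definition m4 : R := normc lambda `^ (- (1 / 2)) * supabs e3.

Definition pcol (j : 'I_4) : R := m1 + m2 + m3 + m4.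
Definition qrow (j : 'I_4) : R := \prod_(i < 4 | i != j) normc (zroot j - zroot i).
Definition Btilde : 'M[R]_4 := \matrix_(j, l) (pcol l / qrow j).

Definition frobenius (n : nat) (A : 'M[R]_n) : R :=
  Num.sqrt (\sum_j \sum_l `|A j l| ^+ 2).

Definition alpha : R := complex.Re (expi ((pi / 2 + theta1) / 2)).

Definition epsilon : R := 4 * alpha^-1 * frobenius Btilde.

End Epsilon.

Definition epsilon_plus : R[i] -> R := epsilon [set x | 0 <= x].
Definition epsilon_minus : R[i] -> R := epsilon [set x | x <= 0].

(* (E) is rho'''' + c_3 rho''' + c_2 rho'' + c_1 rho' + c_0 rho = 0 with
   c_j = evans_coef lambda j. *)
Definition evans_coef (lambda : R[i]) (j : 'I_4) (x : R) : R[i] :=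
  nth 0 [:: (2 / k ^+ 2)%:C * (lambda * (e0 x)%:C + lambda ^+ 2);
            (2 / k ^+ 2)%:C * ((e1 x)%:C + lambda * (e1' x)%:C);
            (2 / k ^+ 2)%:C * ((e2 x)%:C - lambda * mu%:C);
            (2 * (s * mu / k ^+ 2 - r^`() x / r x))%:C] j.

Definition evans_system (lambda : R[i]) (x : R) : 'M[R[i]]_4 :=
  \matrix_(i < 4, j < 4)
    if val i == 3%N then - evans_coef lambda j x else (val j == i.+1)%:R.

End Coefficients.

Section Evans.
Variable R : realType.
Implicit Types (F : set_system R) (A : R -> 'M[R[i]]_4) (Y : R -> 'cV[R[i]]_4).

(* Y' = A(x) Y on the whole line, with Y -> 0 along F (x -> +oo or x -> -oo). *)
Definition decaying_solution A F Y : Prop :=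
  (forall x i, is_cderive (fun y => Y y i 0) x ((A x *m Y x) i 0)) /\
  (forall i, ccvg F (fun x => Y x i 0) 0).

Definition decaying_basis A F Y1 Y2 : Prop :=
  [/\ decaying_solution A F Y1, decaying_solution A F Y2,
      (forall a b : R[i], (forall x, a *: Y1 x + b *: Y2 x = 0) ->
         a = 0 /\ b = 0)
    & forall Y, decaying_solution A F Y ->
        exists a b : R[i], forall x, Y x = a *: Y1 x + b *: Y2 x].

(* Two eigenvalues with positive and two with negative real part, counted
   with algebraic multiplicity. *)
Definition splits22 (M : 'M[R[i]]_4) : Prop :=
  exists rs : seq R[i],
    [/\ char_poly M = \prod_(z <- rs) ('X - z%:P),
        count (fun z => 0 < complex.Re z) rs = 2%N
      & count (fun z => complex.Re z < 0) rs = 2%N].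

Definition limit_splits22 A F : Prop :=
  exists M : 'M[R[i]]_4,
    (forall i j, ccvg F (fun x => A x i j) (M i j)) /\ splits22 M.

(* [e] is the value of the Evans function of Y' = A(x) Y for some choice of
   bases; in particular the Evans function is defined. *)
Definition is_evans_value A (e : R[i]) : Prop :=
  [/\ limit_splits22 A -oo, limit_splits22 A +oo
    & exists Y1m Y2m Y1p Y2p : R -> 'cV[R[i]]_4,
      [/\ decaying_basis A -oo Y1m Y2m, decaying_basis A +oo Y1p Y2p
        & e = \det (row_mx (row_mx (Y1m 0) (Y2m 0))
                           (row_mx (Y1p 0) (Y2p 0)) : 'M[R[i]]_4)]].

Definition evans_defined_nonzero A : Prop :=
  (exists e, is_evans_value A e) /\ (forall e, is_evans_value A e -> e <> 0).

End Evans.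

(* Main.v *)
Require Import Defs.
From mathcomp Require Import all_boot all_order all_algebra.
From mathcomp Require Import complex.
From mathcomp Require Import all_classical all_reals all_analysis.
From mathcomp Require Import ring lra zify.
Import Order.TTheory GRing.Theory Num.Theory.
Import numFieldNormedType.Exports.
Import ComplexField.Normc.
Set Implicit Arguments.
Unset Strict Implicit.
Unset Printing Implicit Defensive.
Local Open Scope classical_set_scope.
Local Open Scope complex_scope.
Local Open Scope ring_scope.

Local Notation Re := complex.Re.
Local Notation Im := complex.Im.

(** For the inequality, the suprema in the m_l are finite, since every
coefficient of (E) is a polynomial in functions that are smooth with limits at
both infinities; hence each m_l is O(|lambda|^(-1/2)), while alpha and the q_j
do not depend on lambda (all q_j equal 4 sin theta1). So both epsilon tend
to 0 (epsilonE, ptotal_decay, epsilon_small).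

For the Evans function, fix lambda. The leading part of (E) has the
characteristic polynomial X^4 - lambda mu X^2 + lambda^2, with the roots A, B,
-A, -B, where A and B are |lambda|^(1/2) e^(i (theta + theta_j) / 2) and have
real part at least a alpha, a = |lambda|^(1/2). Let W be the coordinates of
(rho, rho', rho'', rho''') in the eigenbasis of the leading part. Then
W_i' = Z_i W_i + g, where Z_i is the i-th root and g collects the lower order
terms, and the bound on epsilon makes g small compared with a alpha |W|. Consequently the indefinite form
H = |W_0|^2 + |W_1|^2 - |W_2|^2 - |W_3|^2 satisfies H' >= 2 delta |W|^2 with
delta > 0 along every solution (companion_energy). Everything else follows
from this one inequality and from its robustness under a change of the weights
in H.
- A solution decaying at +oo has H <= 0, as H increases to 0, and one decaying
  at -oo has H >= 0. In both cases H = 0 at a point only for the zero solution.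
  So the two spaces of decaying solutions are transverse, and the determinant
  does not vanish (evans_det_neq0).
- Both spaces have dimension two. At +oo it is at most two, because the cone
  H <= 0 meets the plane W_2 = W_3 = 0 trivially. Conversely, for each n there
  are solutions with W_0 = W_1 = 0 at time n and prescribed W_2, W_3 at time 0;
  they stay in the cone up to time n, and a cluster point of their initial data
  gives a solution that stays in the cone forever, and therefore decays
  (exists_vanishing).
- The limit matrices satisfy the same inequality. By Lyapunov's argument, a
  space spanned by generalised eigenvectors for eigenvalues with positive real
  part is one where H is positive, so it has dimension at most two; the same
  holds for negative real parts, and no eigenvalue is imaginary
  (companion_splits22).
The existence of solutions on the whole line is obtained by Picard iteration
(linear_ode_exists). *)

(** * One-variable calculus *)

Section Calculus.
Variable R : realType.
Implicit Types f g df : R -> R.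

Lemma is_derive_continuous f df : (forall x : R, is_derive x 1 f (df x)) -> continuous f.
Proof.
move=> fd x; apply/differentiable_continuous/derivable1_diffP.
by have := fd x; case.
Qed.

Lemma deriv_opp f (d x : R) : is_derive x 1 f d ->
  is_derive x 1 (fun y => - f y) (- d).
Proof. exact: is_deriveN. Qed.

Lemma deriv_add f g (d d' x : R) : is_derive x 1 f d -> is_derive x 1 g d' ->
  is_derive x 1 (fun y => f y + g y) (d + d').
Proof. by move=> fd gd; exact: is_deriveD. Qed.

Lemma deriv_sub f g (d d' x : R) : is_derive x 1 f d -> is_derive x 1 g d' ->
  is_derive x 1 (fun y => f y - g y) (d - d').
Proof. by move=> fd gd; exact: is_deriveB. Qed.

Lemma deriv_mul f g (d d' x : R) : is_derive x 1 f d -> is_derive x 1 g d' ->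
  is_derive x 1 (fun y => f y * g y) (d * g x + f x * d').
Proof.
move=> fd gd; have h := is_deriveM fd gd.
by apply: (is_derive_eq h); rewrite /GRing.scale/= addrC mulrC.
Qed.

Lemma deriv_scale f (c d x : R) : is_derive x 1 f d ->
  is_derive x 1 (fun y => c * f y) (c * d).
Proof. by move=> fd; exact: is_deriveZ. Qed.

Lemma le_of_derive_ge0 f df a b : a <= b ->
  (forall x : R, a <= x -> x <= b -> is_derive x 1 f (df x)) ->
  (forall x : R, a <= x -> x <= b -> 0 <= df x) -> f a <= f b.
Proof.
move=> ab fd df0.
have [| |c cab] := @MVT_segment R f df a b ab.
- by move=> x /[!in_itv]/= /andP[/ltW ax /ltW xb]; apply: fd.
- apply: derivable_within_continuous => x /[!in_itv]/= /andP[ax xb].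
  by have [] := fd x ax xb.
move: cab => /[!in_itv]/= /andP[ac cb] e.
by rewrite -subr_ge0 e mulr_ge0 ?subr_ge0// df0.
Qed.

Lemma eq_of_derive0 f a b : a <= b ->
  (forall x : R, a <= x -> x <= b -> is_derive x 1 f 0) -> f a = f b.
Proof.
move=> ab fd; apply/eqP; rewrite eq_le; apply/andP; split.
  exact: (@le_of_derive_ge0 f (fun=> 0)).
rewrite -lerN2; apply: (@le_of_derive_ge0 (- f) (fun=> - 0) _ _ ab) => [x ax xb|x _ _].
  exact/is_deriveN/fd.
by rewrite oppr0.
Qed.

Let I f (n : nat) (x : R) : R :=
  (\int[@lebesgue_measure R]_(t in `[- n%:R, x]) f t)%R.

Lemma is_derive_integral f (n : nat) (x : R) : continuous f -> - n%:R < x ->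
  is_derive x 1 (I f n) (f x).
Proof.
move=> cf nx.
have xu : x < x + 1 by rewrite ltrDl.
have [] := @continuous_FTC1_closed R f (- n%:R) x (x + 1) xu _ nx (cf x).
  apply: continuous_compact_integrable; first exact: segment_compact.
  exact: continuous_subspaceT.
move=> d e; rewrite -e derive1E; exact: derivableP.
Qed.

(** The integral from -n is an antiderivative only to the right of -n. Once
normalised to vanish at 0, these integrals agree wherever two of them are
antiderivatives, so that n may be chosen depending on the point. *)
Lemma antiderivative f : continuous f ->
  exists F, F 0 = 0 /\ forall x : R, is_derive x 1 F (f x).
Proof.
move=> cf.
pose G n x := I f n x - I f n 0.
have Gd n (x : R) : - n%:R < x -> is_derive x 1 (G n) (f x).
  move=> nx; have h1 := is_derive_integral cf nx.
  by rewrite -[f x]subr0; exact: is_deriveB.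
have GG (m n : nat) x : (0 < m)%N -> (0 < n)%N -> - m%:R < x -> - n%:R < x -> G m x = G n x.
  move=> m0 n0 mx nx; apply/eqP; rewrite -subr_eq0; apply/eqP.
  have G0 k : G k 0 = 0 by rewrite /G subrr.
  have d (y : R) : - m%:R < y -> - n%:R < y -> is_derive y 1 (G m - G n) 0.
    move=> my ny; have h1 := Gd _ _ my; have h2 := Gd _ _ ny.
    by rewrite -(subrr (f y)); exact: is_deriveB.
  have e0 : (G m - G n) 0 = 0 by rewrite -[LHS]/(G m 0 - G n 0) !G0 subrr.
  have [m1 n1] : - m%:R < 0 :> R /\ - n%:R < 0 :> R by rewrite !oppr_lt0 !ltr0n.
  transitivity ((G m - G n) x) => //; rewrite -[RHS]e0.
  case: (leP 0 x) => [x0|/ltW x0]; [apply/esym|];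
    apply: eq_of_derive0 => // y y1 y2; apply: d.
  - exact: lt_le_trans y1.
  - exact: lt_le_trans y1.
  - exact: lt_le_trans y1.
  - exact: lt_le_trans y1.
pose N (x : R) := (Num.bound `|x|).+1.
have NP x : - (N x)%:R < x.
  rewrite ltrNl (le_lt_trans (ler_norm _))// normrN.
  by rewrite (lt_trans (archi_boundP (normr_ge0 x)))// ltr_nat.
exists (fun x => G (N x) x); split; first by rewrite /G subrr.
move=> x; have h := Gd _ _ (NP x).
apply: near_eq_is_derive h.
near=> y; apply: (GG (N x) (N y) y isT isT _ (NP y)).
by near: y; exact: lt_nbhsr (NP x).
Unshelve. all: by end_near. Qed.


Lemma deriv_sum n (h : 'I_n -> R -> R) (d : 'I_n -> R) (x : R) :
  (forall i, is_derive x 1 (h i) (d i)) ->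
  is_derive x 1 (fun y => \sum_i h i y) (\sum_i d i).
Proof.
move=> hd; rewrite (_ : (fun y => _) = \sum_i h i); first exact: is_derive_sum.
by apply/funext => y; rewrite fct_sumE.
Qed.

Lemma deriv_expM (L x : R) :
  is_derive x 1 (fun y => expR (L * y)) (L * expR (L * x)).
Proof.
have -> : (fun y => expR (L * y)) = expR \o (L \*: id).
  by apply/funext => y.
have h : is_derive x 1 (L \*: id : R -> R) L.
  by apply: is_derive_eq; rewrite /GRing.scale/= mulr1.
by rewrite mulrC; exact: is_derive1_comp.
Qed.

Lemma deriv_refl f (d x : R) :
  is_derive (- x) 1 f d -> is_derive x 1 (fun y => f (- y)) (- d).
Proof.
move=> fd; rewrite -mulrN1.
by apply: (@is_derive1_comp _ f (fun y => - y)) => //.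
Qed.

(** The limit is squeezed between the nondecreasing sequence u_n - 2 c / 2^n and
the nonincreasing sequence u_n + 2 c / 2^n, which also yields the rate. *)
Lemma geometric_cvg (u : nat -> R) (c : R) :
  (forall n, `|u n.+1 - u n| <= c * 2^-1 ^+ n) ->
  exists l, u n @[n --> \oo] --> l /\ forall n, `|l - u n| <= 2 * c * 2^-1 ^+ n.
Proof.
move=> uc.
pose v n := u n - 2 * c * 2^-1 ^+ n; pose w n := u n + 2 * c * 2^-1 ^+ n.
have vS n : v n <= v n.+1.
  have := uc n; rewrite /v exprS ler_norml => /andP[h _].
  by move: h; set p := _ ^+ n; lra.
have wS n : w n.+1 <= w n.
  have := uc n; rewrite /w exprS ler_norml => /andP[_ h].
  by move: h; set p := _ ^+ n; lra.
have vm : nondecreasing_seq v by apply/nondecreasing_seqP.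
have wm : nonincreasing_seq w by apply/nonincreasing_seqP.
have vw m n : v m <= w n.
  have c0 : 0 <= c by have := uc 0; rewrite expr0 mulr1; exact: le_trans.
  rewrite (le_trans (vm _ _ (leq_maxl m n)))//.
  rewrite (le_trans _ (wm _ _ (leq_maxr m n)))//.
  rewrite /v /w lerD2l -subr_ge0 opprK addr_ge0// mulr_ge0// ?exprn_ge0//;
    by rewrite ?invr_ge0 ?mulr_ge0.
have ubv : has_ubound (range v) by exists (w 0) => _ [n _ <-].
have vl := nondecreasing_cvgn vm ubv.
set l := sup _ in vl; exists l.
have vle n : v n <= l by apply: ub_le_sup => //; exists n.
have lew n : l <= w n by apply: ge_sup => [|_ [m _ <-]//]; exists (v 0), 0.
have B n : `|l - u n| <= 2 * c * 2^-1 ^+ n.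
  by have := vle n; have := lew n; rewrite /v /w ler_norml => *; apply/andP; split; lra.
split=> //; rewrite (_ : u = v \+ geometric (2 * c) 2^-1); last first.
  by apply/funext => n; rewrite /= subrK.
rewrite -[l]addr0; apply: cvgD => //; apply: cvg_geometric.
by rewrite ger0_norm ?invr_ge0// invf_lt1 ?ltr1n.
Qed.

Lemma growth_bound1 (F f : R -> R) (c L : R) : 0 < L -> 0 <= c -> F 0 = 0 ->
  (forall x : R, is_derive x 1 F (f x)) ->
  (forall x, 0 <= x -> f x <= c * expR (L * x)) ->
  forall x, 0 <= x -> F x <= c / L * expR (L * x).
Proof.
move=> L0 c0 F0 Fd fc x x0.
pose G := (c / L) \*: (fun y => expR (L * y)) - F.
have : G 0 <= G x.
  apply: (@le_of_derive_ge0 G (fun y => (c / L) *: (L * expR (L * y)) - f y)) => //.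
    move=> y _ _; apply: is_deriveB; apply: is_deriveZ; exact: deriv_expM.
  move=> y y0 _; rewrite subr_ge0 (le_trans (fc _ y0))//.
  by rewrite /GRing.scale/= mulrA divfK// gt_eqF.
rewrite -[G 0]/(c / L * expR (L * 0) - F 0) -[G x]/(c / L * expR (L * x) - F x).
rewrite F0 mulr0 expR0 => h.
have : 0 <= c / L by rewrite divr_ge0// ltW.
by lra.
Qed.

(** Integrating from 0 gains a factor 1 / L on bounds relative to
exp (L |x|). With this weight Picard iteration contracts on the whole line. *)
Lemma growth_bound (F f : R -> R) (c L : R) : 0 < L -> F 0 = 0 ->
  (forall x : R, is_derive x 1 F (f x)) ->
  (forall x, `|f x| <= c * expR (L * `|x|)) ->
  forall x, `|F x| <= c / L * expR (L * `|x|).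
Proof.
move=> L0 F0 Fd fc x.
have c0 : 0 <= c.
  by have := fc 0; rewrite normr0 mulr0 expR0 mulr1; exact: le_trans.
have key (G g : R -> R) : G 0 = 0 -> (forall x : R, is_derive x 1 G (g x)) ->
    (forall x, `|g x| <= c * expR (L * `|x|)) -> forall x, 0 <= x -> `|G x| <= c / L * expR (L * x).
  move=> G0 Gd gc y y0.
  rewrite ler_norml -[X in X && _]lerNl; apply/andP; split.
    apply: (@growth_bound1 (fun y => - G y) (fun y => - g y)) => //.
    - by rewrite G0 oppr0.
    - move=> z z0; rewrite (le_trans (ler_norm _))// normrN.
      by rewrite (le_trans (gc _))// ger0_norm.
  apply: (@growth_bound1 G g) => // z z0.
  by rewrite (le_trans (ler_norm _))// (le_trans (gc _))// ger0_norm.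
case: (leP 0 x) => x0; first by rewrite (ger0_norm x0); exact: key.
rewrite [`|x|]ltr0_norm//; have -> : F x = F (- - x) by rewrite opprK.
apply: (key (fun y => F (- y)) (fun y => - f (- y))).
- by rewrite oppr0.
- by move=> y; exact: deriv_refl.
- by move=> y; rewrite normrN (le_trans (fc _))// normrN.
- by rewrite oppr_ge0 ltW.
Qed.

End Calculus.

(** * Existence for linear differential systems *)

Section LinearODE.
Variable R : realType.

Lemma geometric_le0 (z c : R) : (forall n, `|z| <= c * 2^-1 ^+ n) -> z = 0.
Proof.
move=> zc; apply/eqP; rewrite -normr_eq0 eq_le normr_ge0 andbT.
have h : geometric c 2^-1 n @[n --> \oo] --> (0 : R).
  by apply: cvg_geometric; rewrite ger0_norm ?invr_ge0// invf_lt1 ?ltr1n.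
rewrite -(cvg_lim _ h)//; apply: limr_ge; first by apply/cvg_ex; exists 0.
by apply: nearW => n; exact: zc.
Qed.

Lemma cvg_sum (T : Type) (F : set_system T) (FF : Filter F) n
    (h : 'I_n -> T -> R) (l : 'I_n -> R) :
  (forall i, h i x @[x --> F] --> l i) ->
  \sum_i h i x @[x --> F] --> \sum_i l i.
Proof. by move=> hl; apply: (cvg_big (op := +%R) add_continuous). Qed.

Variable N : nat.
Implicit Types (a : 'I_N -> 'I_N -> R -> R) (y : 'I_N -> R -> R).

Definition vfield a y (i : 'I_N) (x : R) : R := \sum_j a i j x * y j x.

Definition solution a y := forall i (x : R), is_derive x 1 (y i) (vfield a y i x).

Definition bounded_coefs a := exists M : R, forall i j x, `|a i j x| <= M.

Lemma vfield_bound a y M B i (x : R) : 0 <= M -> (forall i j x, `|a i j x| <= M) ->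
  (forall j, `|y j x| <= B) -> `|vfield a y i x| <= N%:R * M * B.
Proof.
move=> M0 aM yB; rewrite (le_trans (ler_norm_sum _ _ _))//.
apply: (@le_trans _ _ (\sum_(j < N) M * B)); last first.
  by rewrite sumr_const card_ord -mulrA mulr_natl.
by apply: ler_sum => j _; rewrite normrM ler_pM.
Qed.

Lemma vfield_continuous a y i : (forall i j, continuous (a i j)) ->
  (forall i, continuous (y i)) -> continuous (vfield a y i).
Proof.
move=> ac yc; move=> x; apply: cvg_sum => j; apply: cvgM; [exact: ac|exact: yc].
Qed.

Lemma vfieldB a y y' i (x : R) :
  vfield a y i x - vfield a y' i x = vfield a (fun j x => y j x - y' j x) i x.
Proof. by rewrite /vfield -sumrB; apply: eq_bigr => j _; rewrite mulrBr. Qed.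

(** Picard iteration. In the weight exp (L |x|), with L at least twice the norm
of the coefficients, each step halves distances, so that the iterates converge
geometrically on the whole line at once. *)
Lemma linear_ode_exists a (v : 'I_N -> R) :
  (forall i j, continuous (a i j)) -> bounded_coefs a ->
  exists y, solution a y /\ forall i, y i 0 = v i.
Proof.
move=> ac [M0 aM0].
have [M M_ge0 aM] : exists2 M : R, 0 <= M & forall i j x, `|a i j x| <= M.
  by exists `|M0| => // i j x; rewrite (le_trans (aM0 _ _ _))// ler_norm.
have [prim primP] : {p : (R -> R) -> R -> R & forall f, continuous f ->
    p f 0 = 0 /\ forall x : R, is_derive x 1 (p f) (f x)}.
  apply: (@choice _ _ (fun f p => continuous f ->
    p 0 = 0 /\ forall x : R, is_derive x 1 p (f x))) => f.
  have [cf|ncf] := pselect (continuous f); last by exists f.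
  by have [F FP] := antiderivative cf; exists F.
pose step y i x := v i + prim (vfield a y i) x.
have stepd y i (x : R) : (forall i, continuous (y i)) ->
    is_derive x 1 (step y i) (vfield a y i x).
  move=> yc; have [_ h] := primP _ (vfield_continuous (i := i) ac yc).
  by rewrite -[vfield _ _ _ _]add0r; exact: (deriv_add (is_derive_cst (v i) x 1) (h x)).
have step0 y i : (forall i, continuous (y i)) -> step y i 0 = v i.
  move=> yc; rewrite /step.
  by have [-> _] := primP _ (vfield_continuous (i := i) ac yc); rewrite addr0.
pose P := fix P n := if n is n.+1 then step (P n) else fun i _ => v i.
have Pc n i : continuous (P n i).
  elim: n i => [|n IH] i; first by move=> x; exact: cvg_cst.
  by apply: (is_derive_continuous (df := vfield a (P n) i)) => x; exact: stepd.
pose V := \sum_i `|v i|.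
pose L := 2 * (N%:R * M) + 1.
have NM0 : 0 <= N%:R * M by rewrite mulr_ge0.
have L0 : 0 < L by rewrite /L; lra.
have LNM : N%:R * M / L <= 2^-1 by rewrite ler_pdivrMr// /L; lra.
pose c := N%:R * M * V / L.
have c0 : 0 <= c by apply: divr_ge0; [rewrite mulr_ge0// sumr_ge0|exact: ltW].
have half y y' i B x : (forall i, continuous (y i)) ->
    (forall i, continuous (y' i)) ->
    (forall j x, `|y j x - y' j x| <= B * expR (L * `|x|)) ->
    `|step y i x - step y' i x| <= B / 2 * expR (L * `|x|).
  move=> yc yc' yB.
  have B0 : 0 <= B by have := yB i 0; rewrite normr0 mulr0 expR0 mulr1; exact: le_trans.
  apply: (@le_trans _ _ (N%:R * M * B / L * expR (L * `|x|))); last first.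
    by rewrite ler_wpM2r ?expR_ge0// mulrAC mulrC ler_wpM2l.
  apply: (@growth_bound _ (fun x => step y i x - step y' i x)
    (fun x => vfield a y i x - vfield a y' i x)) => // [|z|z].
  - by rewrite !step0// subrr.
  - by apply: (deriv_sub (stepd _ _ _ yc) (stepd _ _ _ yc')).
  - by rewrite vfieldB -mulrA; apply: vfield_bound => // j; exact: yB.
have PB n i x : `|P n.+1 i x - P n i x| <= c * 2^-1 ^+ n * expR (L * `|x|).
  elim: n i x => [|n IH] i x.
    rewrite expr0 mulr1 /=.
    apply: (@growth_bound _ (fun x => step (P 0) i x - v i) (vfield a (P 0) i)) => // [|z|z].
    - by rewrite step0 ?subrr//; exact: (Pc 0).
    - rewrite -[vfield _ _ _ _]subr0.
      exact: (deriv_sub (stepd _ _ _ (Pc 0)) (is_derive_cst (v i) z 1)).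
    - rewrite (le_trans (vfield_bound (B := V) _ _ aM _))//.
        by move=> j; rewrite /V (bigD1 j)//= lerDl sumr_ge0.
      rewrite ler_peMr ?mulr_ge0 ?sumr_ge0//.
      by rewrite -expR0 ler_expR mulr_ge0// ltW.
  by rewrite exprSr mulrA; apply: half => [j|j|j z]; [exact: (Pc n.+1)|exact: Pc|exact: IH].
have PB' i x n : `|P n.+1 i x - P n i x| <= (c * expR (L * `|x|)) * 2^-1 ^+ n.
  by rewrite mulrAC.
have [y yP] : exists y, forall i x, P n i x @[n --> \oo] --> y i x /\
   forall n, `|y i x - P n i x| <= 2 * (c * expR (L * `|x|)) * 2^-1 ^+ n.
  have h (i : 'I_N) x := geometric_cvg (PB' i x).
  have h1 (i : 'I_N) : exists g, forall x, P n i x @[n --> \oo] --> g x /\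
     forall n, `|g x - P n i x| <= 2 * (c * expR (L * `|x|)) * 2^-1 ^+ n.
    by have [g gP] := choice (h i); exists g.
  by have [y yP] := choice h1; exists y.
have yc i : continuous (y i).
  move=> x0; apply/cvgrPdist_le => e e0.
  pose K := 2 * (c * expR (L * (`|x0| + 1))).
  have K0 : 0 <= K by apply: mulr_ge0 => //; apply: mulr_ge0 => //; exact: expR_ge0.
  have [n nK] : exists n, K * 2^-1 ^+ n <= e / 3.
    have e3 : 0 < e / 3 by lra.
    have h : geometric K 2^-1 n @[n --> \oo] --> (0 : R).
      by apply: cvg_geometric; rewrite ger0_norm ?invr_ge0// invf_lt1 ?ltr1n.
    have [n _ nP] := cvgr_dist_le _ _ h _ e3.
    exists n; apply: le_trans (nP n (leqnn n)).
    by rewrite sub0r normrN ler_norm.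
  have yK x : `|x| <= `|x0| + 1 -> `|y i x - P n i x| <= e / 3.
    move=> xx0; apply: le_trans nK; have [_ /(_ n) h] := yP i x.
    apply: le_trans h _; rewrite ler_wpM2r ?exprn_ge0 ?invr_ge0//.
    by rewrite ler_wpM2l// ler_wpM2l// ler_expR ler_wpM2l// ltW.
  have near1 : \forall x \near x0, `|P n i x0 - P n i x| <= e / 3.
    by apply: (cvgr_dist_le _ _ (Pc n i x0)); lra.
  have near2 : \forall x \near x0, `|x0 - x| <= 1.
    have := nbhsx_ballx x0 1 ltr01; apply: filterS => x.
    by rewrite -ball_normE; exact: ltW.
  apply: filterS2 near1 near2 => x h1 xx0.
  have h2 : `|y i x - P n i x| <= e / 3.
    by apply: yK; rewrite -lerBlDl (le_trans (lerB_dist _ _))// distrC.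
  have h3 : `|y i x0 - P n i x0| <= e / 3 by apply: yK; rewrite lerDl.
  rewrite (_ : y i x0 - y i x = (y i x0 - P n i x0) + (P n i x0 - P n i x) - (y i x - P n i x)); last by ring.
  rewrite (le_trans (ler_normB _ _))// (le_trans (lerD (ler_normD _ _) (lexx _)))//.
  lra.
(* P n.+1 is the image of P n under the step, so it converges both to y and to
   the image of y. *)
have yE i : y i = step y i.
  apply/funext => x; apply/eqP; rewrite -subr_eq0; apply/eqP.
  apply: (@geometric_le0 _ (2 * (c * expR (L * `|x|)))) => n.
  have h1 : `|P n.+1 i x - step y i x| <= (2 * c * 2^-1 ^+ n) / 2 * expR (L * `|x|).
    apply: half; [exact: Pc|exact: yc|move=> j z].
    rewrite distrC; have [_ /(_ n) h] := yP j z.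
    by rewrite (le_trans h)// le_eqVlt; apply/orP; left; apply/eqP; ring.
  have h2 : `|y i x - P n.+1 i x| <= 2 * (c * expR (L * `|x|)) * 2^-1 ^+ n.+1.
    by have [_] := yP i x; exact.
  rewrite -(subrKA (P n.+1 i x)) (le_trans (ler_normD _ _))//.
  by rewrite (le_trans (lerD h2 h1))// exprS le_eqVlt; apply/orP; left; apply/eqP; field.
exists y; split=> [i x|i].
  by rewrite yE; have := stepd y i x yc; rewrite -yE.
by rewrite yE step0.
Qed.

End LinearODE.

(** * Quadratic forms along solutions, and uniqueness *)

Section Energy.
Variable R : realType.

(** Gronwall's inequality in monotone form; k may have either sign. *)
Lemma exp_weighted_le (V dV : R -> R) (k x y : R) : x <= y ->
  (forall z : R, is_derive z 1 V (dV z)) -> (forall z, 0 <= dV z + k * V z) ->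
  V x * expR (k * x) <= V y * expR (k * y).
Proof.
move=> xy Vd VdV.
apply: (@le_of_derive_ge0 _ (fun z => V z * expR (k * z))
  (fun z => dV z * expR (k * z) + V z * (k * expR (k * z)))) => // z _ _.
  exact: (deriv_mul (Vd z) (deriv_expM k z)).
by rewrite mulrA -mulrDl mulr_ge0 ?expR_ge0// [V z * k]mulrC.
Qed.

Variable N : nat.
Implicit Types (a : 'I_N -> 'I_N -> R -> R) (y : 'I_N -> R -> R).

Definition wform (c : 'I_N -> R) y (x : R) : R := \sum_i c i * y i x ^+ 2.

Lemma deriv_wform c a y (x : R) : solution a y ->
  is_derive x 1 (wform c y) (2 * \sum_i c i * (y i x * vfield a y i x)).
Proof.
move=> ys; rewrite mulr_sumr; apply: deriv_sum => i.
rewrite (_ : (fun t : R => _) = (fun z => c i * (y i z * y i z))); last first.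
  by apply/funext => z; rewrite expr2.
rewrite (_ : 2 * _ = c i * (vfield a y i x * y i x + y i x * vfield a y i x)); last by ring.
exact/deriv_scale/deriv_mul.
Qed.

Lemma sqnorm_eq0 y (x : R) : wform (fun=> 1) y x <= 0 -> forall i, y i x = 0.
Proof.
move=> y0 i; apply/eqP; rewrite -sqrf_eq0 eq_le sqr_ge0 andbT.
apply: le_trans y0; rewrite /wform (bigD1 i)//= mul1r lerDl.
by apply: sumr_ge0 => j _; rewrite mul1r sqr_ge0.
Qed.

(** The squared norm E satisfies |E'| <= K E, and Gronwall's inequality applies
on both sides of x0. *)
Lemma solution_unique0 a y (x0 : R) : bounded_coefs a -> solution a y ->
  (forall i, y i x0 = 0) -> forall i x, y i x = 0.
Proof.
move=> [M aM] ys y0 i x; apply: sqnorm_eq0.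
pose E := wform (fun=> 1) y.
pose dE z := 2 * \sum_i 1 * (y i z * vfield a y i z).
have Ed (z : R) : is_derive z 1 E (dE z) by exact: deriv_wform.
pose K := 2 * (N%:R * M).
have dEK z : `|dE z| <= K * E z.
  rewrite /dE normrM ger0_norm// /K -mulrA ler_wpM2l//.
  apply: (@le_trans _ _ (\sum_i \sum_j M * ((y i z ^+ 2 + y j z ^+ 2) / 2))).
    rewrite (le_trans (ler_norm_sum _ _ _))//; apply: ler_sum => k _.
    rewrite mul1r /vfield mulr_sumr (le_trans (ler_norm_sum _ _ _))//.
    apply: ler_sum => j _.
    have -> : y k z * (a k j z * y j z) = a k j z * (y k z * y j z) by ring.
    rewrite normrM ler_pM// ler_norml.
    have := sqr_ge0 (y k z - y j z); have := sqr_ge0 (y k z + y j z).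
    by move=> h1 h2; apply/andP; split; lra.
  rewrite le_eqVlt; apply/orP; left; apply/eqP.
  under eq_bigr do rewrite -mulr_sumr -mulr_suml.
  rewrite -mulr_sumr -mulr_suml.
  under eq_bigr do rewrite big_split/= sumr_const card_ord.
  rewrite big_split/= sumr_const card_ord sumrMnl -mulr_natl.
  have -> : E z = \sum_i y i z ^+ 2 by apply: eq_bigr => j _; rewrite mul1r.
  by set S := \sum_i _; rewrite -[in LHS]mulr_natl; field.
have E0 : E x0 = 0 by rewrite /E /wform big1// => j _; rewrite y0 expr0n/= mulr0.
have [xx0|/ltW xx0] := leP x x0.
  have : E x * expR (K * x) <= E x0 * expR (K * x0).
    apply: exp_weighted_le Ed _ => //.
    move=> z.
    by have := dEK z; rewrite ler_norml => /andP[]; lra.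
  by rewrite E0 mul0r pmulr_lle0// expR_gt0.
have : - E x0 * expR (- K * x0) <= - E x * expR (- K * x).
  apply: (@exp_weighted_le (fun z => - E z) (fun z => - dE z)) => // z.
  by have := dEK z; rewrite ler_norml => /andP[]; lra.
by rewrite E0 oppr0 mul0r mulNr oppr_ge0 pmulr_lle0// expR_gt0.
Qed.

End Energy.

(** * Dichotomy for real systems with a growing indefinite form *)

Section Dichotomy.
Variables (R : realType) (N : nat).
Implicit Types (a : 'I_N -> 'I_N -> R -> R) (y : 'I_N -> R -> R).
Implicit Types (sg : 'I_N -> bool).

(** sg tells which coordinates are expected to grow. *)
Definition signed sg (cu cs : R) (i : 'I_N) : R := if sg i then cu else - cs.

(** The form with weights 1, 1 defines an invariant cone. Unequal weights give a
form that is comparable with the norm inside the cone, which turns invariance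
into exponential decay. Allowing all weights in [1, 2] on both sides makes the
condition symmetric under time reversal. *)
Definition energy_growth sg a (delta : R) := forall cu cs, 1 <= cu <= 2 ->
  1 <= cs <= 2 -> forall x (v : 'I_N -> R),
  delta * \sum_i v i ^+ 2 <=
    \sum_i signed sg cu cs i * (v i * \sum_j a i j x * v j).

Definition vanishes (F : set_system R) y := forall i, y i x @[x --> F] --> 0.

Lemma wform_cvg0 c (F : set_system R) {FF : Filter F} y :
  vanishes F y -> wform c y x @[x --> F] --> 0.
Proof.
move=> y0; rewrite -[X in _ --> X](_ : \sum_(i < N) c i * (0 * 0) = 0); last first.
  by rewrite big1// => i _; rewrite !mulr0.
apply: cvg_sum => i; under eq_cvg do rewrite expr2.
apply: cvgM; first exact: cvg_cst.
by apply: cvgM; exact: y0.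
Qed.

Lemma energy_nondecreasing sg a delta cu cs y x z : 0 <= delta ->
  energy_growth sg a delta -> 1 <= cu <= 2 -> 1 <= cs <= 2 -> solution a y ->
  x <= z -> wform (signed sg cu cs) y x <= wform (signed sg cu cs) y z.
Proof.
move=> d0 eg cu12 cs12 ys xz.
apply: (le_of_derive_ge0 xz) => [t _ _|t _ _]; first exact: deriv_wform ys.
apply: mulr_ge0 => //; apply: le_trans (eg _ _ cu12 cs12 t (y^~ t)).
by rewrite mulr_ge0// sumr_ge0// => i _; exact: sqr_ge0.
Qed.

Let in12_1 : 1 <= (1 : R) <= 2. Proof. by rewrite lexx ler1n. Qed.
Let in12_2 : 1 <= (2 : R) <= 2. Proof. by rewrite lexx ler1n. Qed.

(** The form increases to 0, hence is nonpositive everywhere. If it is 0 at time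
0, it has a maximum there, and its derivative, which dominates the squared norm,
vanishes. *)
Lemma energy_of_vanishing sg a delta y : 0 < delta -> energy_growth sg a delta ->
  solution a y -> vanishes +oo y ->
  wform (signed sg 1 1) y 0 <= 0 /\
  (wform (signed sg 1 1) y 0 = 0 -> forall i, y i 0 = 0).
Proof.
move=> d0 eg ys yv.
have le0 x : wform (signed sg 1 1) y x <= 0.
  rewrite -(cvg_lim _ (wform_cvg0 (signed sg 1 1) yv))//.
  apply: limr_ge; first by apply/cvg_ex; exists 0; exact: wform_cvg0.
  near=> z; apply: (energy_nondecreasing (ltW d0) eg in12_1 in12_1 ys).
  by near: z; exact: (nbhs_pinfty_ge (num_real _)).
split=> // y0.
have Hd (x : R) := deriv_wform (signed sg 1 1) x ys.
have [_ e1] : is_derive (0 : R) 1 (wform (signed sg 1 1) y) 0.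
  apply: (@derive1_at_max _ _ (- 1) 1) => [|t _||t _].
  - by rewrite lerNl (le_trans _ ler01)// oppr_le0.
  - by have [] := Hd t.
  - by rewrite in_itv/= oppr_lt0 ltr01.
  - by rewrite y0.
have [_ e2] := Hd 0; move: e2; rewrite e1 => e2.
apply: sqnorm_eq0; rewrite /wform; under eq_bigr do rewrite mul1r.
have := eg _ _ in12_1 in12_1 0 (y^~ 0).
rewrite (_ : \sum_i _ * (_ * _) = 0); first by rewrite pmulr_rle0.
by apply: (@mulfI _ 2); rewrite ?pnatr_eq0// -e2 mulr0.
Unshelve. all: by end_near. Qed.

(** Time reversal exchanges growing and decaying coordinates; it transfers the
results at +oo to -oo. *)
Definition refl_coefs a i j (x : R) := - a i j (- x).

Lemma refl_solution a y : solution a y -> solution (refl_coefs a) (fun i x => y i (- x)).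
Proof.
move=> ys i x; rewrite (_ : vfield _ _ _ _ = - vfield a y i (- x)).
  exact/deriv_refl/ys.
by rewrite /vfield -sumrN; apply: eq_bigr => j _; rewrite mulNr.
Qed.

Lemma refl_energy_growth sg a delta : energy_growth sg a delta ->
  energy_growth (fun i => ~~ sg i) (refl_coefs a) delta.
Proof.
move=> eg cu cs cu12 cs12 x v; apply: le_trans (eg _ _ cs12 cu12 (- x) v) _.
apply: ler_sum => i _; rewrite le_eqVlt; apply/orP; left; apply/eqP.
under [in RHS]eq_bigr do rewrite mulNr.
by rewrite sumrN /signed; case: (sg i) => /=; ring.
Qed.

Lemma energy_of_vanishingN sg a delta y : 0 < delta -> energy_growth sg a delta ->
  solution a y -> vanishes -oo y ->
  0 <= wform (signed sg 1 1) y 0 /\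
  (wform (signed sg 1 1) y 0 = 0 -> forall i, y i 0 = 0).
Proof.
move=> d0 eg ys yv.
have := energy_of_vanishing d0 (refl_energy_growth eg) (refl_solution ys).
rewrite (_ : wform _ _ 0 = - wform (signed sg 1 1) y 0); last first.
  rewrite /wform -sumrN; apply: eq_bigr => i _; rewrite oppr0 /signed.
  by case: (sg i) => /=; ring.
case=> [i|le0 eq0].
  exact/cvgNy_compNP/yv.
by split=> [|e i]; [rewrite -oppr_le0|have := eq0 _ i; rewrite e !oppr0; exact].
Qed.


Lemma le_of_closure (T : topologicalType) (f : T -> R) (c : R) (p : T) :
  continuous f -> closure [set w | f w <= c] p -> f p <= c.
Proof.
move=> fc clp; have cl : closed (f @^-1` [set x | x <= c]).
  by apply: closed_comp => [x _|]; [exact: fc|exact: closed_le].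
by move: clp; rewrite -[closure _](closure_id _).1.
Qed.

Lemma vanishes_exp (f : R -> R) (K delta : R) : 0 < delta ->
  (forall x, 0 <= x -> f x ^+ 2 * expR (delta * x) <= K) ->
  f x @[x --> +oo] --> 0.
Proof.
move=> d0 fK; have K0 : 0 <= K.
  by apply: le_trans (fK 0 (lexx 0)); rewrite mulr_ge0 ?sqr_ge0 ?expR_ge0.
apply/cvgrPdist_le => e e0; near=> x.
have x0 : 0 <= x by near: x; exact: (nbhs_pinfty_ge (num_real _)).
have xK : K / e ^+ 2 / delta <= x by near: x; exact: (nbhs_pinfty_ge (num_real _)).
have key : f x ^+ 2 * expR (delta * x) <= e ^+ 2 * expR (delta * x); last first.
  rewrite sub0r normrN -(ger0_norm (ltW e0)) -ler_sqr ?nnegrE// !real_normK ?num_real//.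
  by move: key; rewrite ler_pM2r ?expR_gt0.
rewrite (le_trans (fK x x0))//.
rewrite -ler_pdivrMl ?exprn_gt0// mulrC.
apply: le_trans (expR_ge1Dx _); rewrite -[leLHS]add0r lerD//.
by rewrite -ler_pdivrMl// mulrC.
Unshelve. all: by end_near. Qed.

(** For each n there is a solution whose growing coordinates vanish at time n and
whose decaying coordinates at time 0 are the prescribed ones. Its form is
nonpositive at time n, hence at all earlier times; at time 0 this bounds the
initial data. A cluster point of these data gives a solution whose form is
nonpositive at all times. On such a solution the form with weights 1, 2 controls
the squared norm, and it decays exponentially. *)
Lemma exists_vanishing sg a delta (v : 'I_N -> R) : 0 < delta ->
  (forall i j, continuous (a i j)) -> bounded_coefs a -> energy_growth sg a delta ->
  exists y, [/\ solution a y, vanishes +oo y & forall i, ~~ sg i -> y i 0 = v i].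
Proof.
move=> d0 ac ab eg.
have [Phi PhiP] : {Phi : 'I_N -> 'I_N -> R -> R & forall j,
    solution a (Phi j) /\ forall i, Phi j i 0 = (j == i)%:R}.
  apply: (@choice _ _ (fun j (y : 'I_N -> R -> R) =>
    solution a y /\ forall i, y i 0 = (j == i)%:R)) => j.
  exact: (linear_ode_exists (fun i => (j == i)%:R)).
pose Y (w : 'rV[R]_N) i x := \sum_j w 0 j * Phi j i x.
have Ys w : solution a (Y w).
  move=> i x; rewrite (_ : vfield _ _ _ _ = \sum_j w 0 j * vfield a (Phi j) i x).
    apply: deriv_sum => j; apply: deriv_scale; exact: (PhiP j).1.
  rewrite /vfield; under eq_bigr do rewrite mulr_sumr.
  under [RHS]eq_bigr do rewrite mulr_sumr.
  rewrite exchange_big/=; apply: eq_bigr => j _; apply: eq_bigr => k _; ring.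
have Y0 w i : Y w i 0 = w 0 i.
  rewrite /Y (bigD1 i)//= (PhiP i).2 eqxx mulr1 big1 ?addr0// => j ji.
  by rewrite (PhiP j).2 (negPf ji) mulr0.
pose H y x := wform (signed sg 1 1) y x.
have Hmono y x z : solution a y -> x <= z -> H y x <= H y z.
  by move=> ys; exact: (energy_nondecreasing (ltW d0) eg).
(* Right multiplication by A n sends initial data to the growing coordinates at
   time n together with the decaying coordinates at time 0. *)
pose A (n : nat) := \matrix_(j, i) (if sg i then Phi j i n%:R else (j == i)%:R).
have AE n w i : (w *m A n) 0 i = if sg i then Y w i n%:R else w 0 i.
  rewrite mxE; under eq_bigr do rewrite mxE; case: ifP => // _.
  rewrite (bigD1 i)//= eqxx mulr1 big1 ?addr0// => j ji.
  by rewrite (negPf ji) mulr0.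
have Hle0 y x : (forall i, sg i -> y i x = 0) -> H y x <= 0.
  move=> y0; rewrite /H /wform; apply: sumr_le0 => i _; rewrite /signed.
  case: ifPn => si; first by rewrite y0// expr0n mulr0.
  by rewrite mulN1r oppr_le0 sqr_ge0.
(* Data in the kernel have a nonnegative form at time 0 and a nonpositive one at
   the later time n. *)
have Aunit n : A n \in unitmx.
  rewrite -row_free_unit; apply: inj_row_free => w /rowP w0.
  have Yw i : sg i -> Y w i n%:R = 0.
    by move=> si; have := w0 i; rewrite AE si mxE.
  have ws i : ~~ sg i -> w 0 i = 0.
    by move=> si; have := w0 i; rewrite AE (negPf si) mxE.
  have h : H (Y w) 0 <= 0 by apply: le_trans (Hle0 _ _ Yw); exact: Hmono.
  apply/rowP => i; rewrite mxE -Y0; apply: sqnorm_eq0; apply: le_trans h.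
  apply: ler_sum => j _; rewrite /signed; case: ifPn => // sj.
  by rewrite Y0 ws// expr0n !mulr0.
pose vs := \row_i (if sg i then 0 else v i).
pose w n := vs *m invmx (A n).
have wP n i : if sg i then Y (w n) i n%:R = 0 else w n 0 i = v i.
  by have := AE n (w n) i; rewrite mulmxKV// mxE; case: ifP.
pose B := \sum_i v i ^+ 2 + 1.
have B1 : 1 <= B by rewrite lerDr sumr_ge0// => i _; exact: sqr_ge0.
have wB n i : `|w n 0 i| <= B.
  have h : H (Y (w n)) 0 <= 0.
    apply: (@le_trans _ _ (H (Y (w n)) n%:R)); first exact: Hmono.
    by apply: Hle0 => j sj; have := wP n j; rewrite sj.
  have w2 : w n 0 i ^+ 2 <= B.
    have [si|si] := boolP (sg i); last first.
      have := wP n i; rewrite (negPf si) => ->.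
      rewrite /B (bigD1 i)//= -addrA lerDl addr_ge0// sumr_ge0// => j _.
      exact: sqr_ge0.
    move: h; rewrite /H /wform (bigD1 i)//= {1}/signed si mul1r Y0 => h.
    apply: le_trans (_ : \sum_(j | j != i) v j ^+ 2 <= _).
      apply: (@le_trans _ _ (- \sum_(j | j != i) signed sg 1 1 j * Y (w n) j 0 ^+ 2)).
        by rewrite -subr_le0 opprK.
      rewrite -sumrN; apply: ler_sum => j _; rewrite /signed Y0.
      have := wP n j; case: ifP => sj e.
        by rewrite mul1r (le_trans _ (sqr_ge0 _))// oppr_le0 sqr_ge0.
      by rewrite mulN1r opprK e.
    rewrite /B [in leRHS](bigD1 i)//= -addrA addrCA lerDl addr_ge0//.
    exact: sqr_ge0.
  rewrite -ler_sqr ?nnegrE// ?(le_trans ler01 B1)// real_normK ?num_real//.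
  by rewrite (le_trans w2)// expr2 ler_peMl// (le_trans ler01 B1).
have cK : compact [set w : 'rV[R]_N | forall i, `[- B, B]%classic (w ord0 i)].
  by apply: (@rV_compact R N (fun=> `[- B, B]%classic)) => _; exact: segment_compact.
have [|p [_ clp]] := cK (w n @[n --> \oo]) _.
  by exists 0%N => // n _ i /=; rewrite in_itv/= -ler_norml wB.
have closed_prop (f : 'rV[R]_N -> R) c : continuous f ->
    (\forall n \near \oo, f (w n) <= c) -> f p <= c.
  move=> fc fw; apply: le_of_closure fc _.
  by move: clp; rewrite clusterE; apply.
have coord i : continuous (fun w : 'rV[R]_N => w 0 i) by exact: coord_continuous.
have ps i : ~~ sg i -> p 0 i = v i.
  move=> si; have wv n : w n 0 i = v i by have := wP n i; rewrite (negPf si).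
  apply/eqP; rewrite eq_le; apply/andP; split.
    by apply: (closed_prop (fun w => w 0 i)) => //; apply: nearW => n; rewrite wv.
  rewrite -lerN2; apply: (closed_prop (fun w => - w 0 i)).
    by move=> x; apply: (cvgN (coord i x)).
  by apply: nearW => n; rewrite wv.
have Hp x : H (Y p) x <= 0.
  apply: (closed_prop (fun w => H (Y w) x)).
    have lim (F : set_system 'rV[R]_N) (q : 'rV[R]_N) : Filter F ->
        (forall i, w 0 i @[w --> F] --> q 0 i) -> H (Y w) x @[w --> F] --> H (Y q) x.
      move=> FF Fq; apply: cvg_sum => i; apply: cvgM; first exact: cvg_cst.
      have Yc : Y w i x @[w --> F] --> Y q i x.
        by apply: cvg_sum => j; apply: cvgM; [exact: Fq|exact: cvg_cst].
      by under eq_cvg do rewrite expr2; rewrite expr2; exact: cvgM.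
    by move=> q; apply: (lim _ _ (nbhs_filter q)) => i; exact: (coord i q).
  near=> n.
  apply: (@le_trans _ _ (H (Y (w n)) n%:R)).
    by apply: Hmono => //; near: n; exact: nbhs_infty_ger.
  by apply: Hle0 => j sj; have := wP n j; rewrite sj.
exists (Y p); split => // [i|i si]; last by rewrite Y0 ps.
pose V x := - wform (signed sg 1 2) (Y p) x.
pose S x := wform (fun=> 1) (Y p) x.
have VS x : S x <= 2 * V x /\ V x <= 2 * S x.
  have e c : wform (signed sg 1 c) (Y p) x =
      \sum_(i | sg i) Y p i x ^+ 2 - c * \sum_(i | ~~ sg i) Y p i x ^+ 2.
    rewrite /wform (bigID sg)/= mulr_sumr -sumrN; congr (_ + _);
      apply: eq_bigr => j sj; rewrite /signed.
      by rewrite sj mul1r.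
    by rewrite (negPf sj) mulNr.
  have eS : S x = \sum_(i | sg i) Y p i x ^+ 2 + \sum_(i | ~~ sg i) Y p i x ^+ 2.
    by rewrite /S /wform (bigID sg)/=; congr (_ + _); apply: eq_bigr => j _; rewrite mul1r.
  have := Hp x; rewrite /H /V !e eS.
  have : 0 <= \sum_(i | sg i) Y p i x ^+ 2 by apply: sumr_ge0 => j _; exact: sqr_ge0.
  have : 0 <= \sum_(i | ~~ sg i) Y p i x ^+ 2 by apply: sumr_ge0 => j _; exact: sqr_ge0.
  by move=> h1 h2 h3; split; lra.
pose dV x := - (2 * \sum_i signed sg 1 2 i * (Y p i x * vfield a (Y p) i x)).
have Vd (x : R) : is_derive x 1 V (dV x) by apply: deriv_opp; exact: deriv_wform.
have dVV x : dV x + delta * V x <= 0.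
  have := eg _ _ in12_1 in12_2 x (fun i => Y p i x).
  have <- : S x = \sum_i Y p i x ^+ 2 by apply: eq_bigr => j _; rewrite mul1r.
  rewrite -/(vfield _ _ _ _) /dV => h.
  have : delta * V x <= 2 * (delta * S x).
    by rewrite mulrCA (ler_wpM2l (ltW d0))//; have [] := VS x.
  by rewrite addrC subr_le0 => /le_trans; apply; rewrite ler_wpM2l.
apply: (@vanishes_exp _ (2 * V 0) delta) => // x x0.
have : - V 0 * expR (delta * 0) <= - V x * expR (delta * x).
  apply: (@exp_weighted_le _ (fun z => - V z) (fun z => - dV z)) => // z.
  by rewrite mulrN -opprD oppr_ge0.
rewrite mulr0 expR0 mulr1 mulNr lerN2 => h.
apply: (@le_trans _ _ (2 * V x * expR (delta * x))); last by rewrite -mulrA ler_wpM2l.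
rewrite ler_wpM2r ?expR_ge0//; have [+ _] := VS x; apply: le_trans.
rewrite /S /wform (bigD1 i)//= mul1r lerDl sumr_ge0// => j _.
by rewrite mul1r sqr_ge0.
Unshelve. all: by end_near. Qed.

Lemma exists_vanishingN sg a delta (v : 'I_N -> R) : 0 < delta ->
  (forall i j, continuous (a i j)) -> bounded_coefs a -> energy_growth sg a delta ->
  exists y, [/\ solution a y, vanishes -oo y & forall i, sg i -> y i 0 = v i].
Proof.
move=> d0 ac [M aM] eg.
have rac i j : continuous (refl_coefs a i j).
  move=> x; apply: cvgN; apply: (@continuous_comp _ _ _ -%R (a i j)); last exact: ac.
  exact: opp_continuous.
have rab : bounded_coefs (refl_coefs a).
  by exists M => i j x; rewrite normrN.
have [y [ys yv y0]] := exists_vanishing v d0 rac rab (refl_energy_growth eg).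
exists (fun i x => y i (- x)); split => [||i si].
- have := refl_solution ys; rewrite (_ : refl_coefs (refl_coefs a) = a)//.
  by apply/funext => i; apply/funext => j; apply/funext => x; rewrite /refl_coefs !opprK.
- by move=> i; apply/cvgNy_compNP; under eq_cvg do rewrite /= opprK; exact: yv.
- by rewrite oppr0 y0// si.
Qed.

End Dichotomy.

(** * Complex-valued functions *)

Section ComplexCoordinates.
Variable R : realType.
Implicit Types z w : R[i].

Lemma cReD z w : Re (z + w) = Re z + Re w. Proof. by case: z w => [a b] [c d]. Qed.
Lemma cImD z w : Im (z + w) = Im z + Im w. Proof. by case: z w => [a b] [c d]. Qed.
Lemma cReM z w : Re (z * w) = Re z * Re w - Im z * Im w.
Proof. by case: z w => [a b] [c d]. Qed.
Lemma cImM z w : Im (z * w) = Re z * Im w + Im z * Re w.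
Proof. by case: z w => [a b] [c d]. Qed.

Lemma Re_sum n (h : 'I_n -> R[i]) : Re (\sum_i h i) = \sum_i Re (h i).
Proof. exact: (big_morph _ cReD). Qed.
Lemma Im_sum n (h : 'I_n -> R[i]) : Im (\sum_i h i) = \sum_i Im (h i).
Proof. exact: (big_morph _ cImD). Qed.

Lemma complex_ext z w : Re z = Re w -> Im z = Im w -> z = w.
Proof. by case: z w => [a b] [c d] /= -> ->. Qed.

Lemma is_cderive_sum n (f : 'I_n -> R -> R[i]) (d : 'I_n -> R[i]) (x : R) :
  (forall i, is_cderive (f i) x (d i)) ->
  is_cderive (fun y => \sum_i f i y) x (\sum_i d i).
Proof.
move=> fd; split.
  rewrite Re_sum (_ : (fun y => _) = fun y => \sum_i Re (f i y)).
    by apply: deriv_sum => i; have [] := fd i.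
  by apply/funext => y; rewrite Re_sum.
rewrite Im_sum (_ : (fun y => _) = fun y => \sum_i Im (f i y)).
  by apply: deriv_sum => i; have [] := fd i.
by apply/funext => y; rewrite Im_sum.
Qed.

Lemma is_cderive_scale (c : R[i]) (f : R -> R[i]) (d : R[i]) (x : R) :
  is_cderive f x d -> is_cderive (fun y => c * f y) x (c * d).
Proof.
move=> [fr fi]; split.
  rewrite cReM (_ : (fun y => _) = fun y => Re c * Re (f y) - Im c * Im (f y)).
    by apply: deriv_sub; exact: deriv_scale.
  by apply/funext => y; rewrite cReM.
rewrite cImM (_ : (fun y => _) = fun y => Re c * Im (f y) + Im c * Re (f y)).
  by apply: deriv_add; exact: deriv_scale.
by apply/funext => y; rewrite cImM.
Qed.

Lemma ccvg_sum (F : set_system R) (FF : Filter F) n (f : 'I_n -> R -> R[i])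
    (l : 'I_n -> R[i]) :
  (forall i, ccvg F (f i) (l i)) -> ccvg F (fun y => \sum_i f i y) (\sum_i l i).
Proof.
move=> fl; split.
  by rewrite Re_sum; under eq_cvg do rewrite Re_sum; apply: cvg_sum => i; have [] := fl i.
by rewrite Im_sum; under eq_cvg do rewrite Im_sum; apply: cvg_sum => i; have [] := fl i.
Qed.

Lemma ccvgM (F : set_system R) (FF : Filter F) (f g : R -> R[i]) (l m : R[i]) :
  ccvg F f l -> ccvg F g m -> ccvg F (fun y => f y * g y) (l * m).
Proof.
move=> [fr fi] [gr gi]; split.
  by rewrite cReM; under eq_cvg do rewrite cReM; apply: cvgB; exact: cvgM.
by rewrite cImM; under eq_cvg do rewrite cImM; apply: cvgD; exact: cvgM.
Qed.

Lemma ccvg_cst (F : set_system R) (FF : Filter F) (l : R[i]) : ccvg F (fun=> l) l.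
Proof. by split; exact: cvg_cst. Qed.

Lemma is_cderive_mulmx m n (T : 'M[R[i]]_(m, n)) (Y : R -> 'cV[R[i]]_n)
    (d : 'cV[R[i]]_n) (x : R) i :
  (forall k, is_cderive (fun y => Y y k 0) x (d k 0)) ->
  is_cderive (fun y => (T *m Y y) i 0) x ((T *m d) i 0).
Proof.
move=> Yd; rewrite mxE (_ : (fun y => _) = fun y => \sum_k T i k * Y y k 0).
  by apply: is_cderive_sum => k; exact: is_cderive_scale.
by apply/funext => y; rewrite mxE.
Qed.

Lemma ccvg_mulmx (F : set_system R) (FF : Filter F) m n (T : 'M[R[i]]_(m, n))
    (Y : R -> 'cV[R[i]]_n) (l : 'cV[R[i]]_n) i :
  (forall k, ccvg F (fun y => Y y k 0) (l k 0)) ->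
  ccvg F (fun y => (T *m Y y) i 0) ((T *m l) i 0).
Proof.
move=> Yl; rewrite mxE (_ : (fun y => _) = fun y => \sum_k T i k * Y y k 0).
  by apply: ccvg_sum => k; apply: ccvgM => //; exact: ccvg_cst.
by apply/funext => y; rewrite mxE.
Qed.

Definition cts_bounded (f : R -> R[i]) :=
  [/\ continuous (fun x => Re (f x)), continuous (fun x => Im (f x)) &
    exists M : R, forall x, `|Re (f x)| <= M /\ `|Im (f x)| <= M].

Lemma cts_bounded_scale (c : R[i]) f : cts_bounded f -> cts_bounded (fun x => c * f x).
Proof.
move=> [fr fi [M fM]]; split.
- rewrite (_ : (fun x => _) = fun x => Re c * Re (f x) - Im c * Im (f x)).
    by move=> x; apply: cvgB; apply: cvgM; [exact: cvg_cst|exact: fr|exact: cvg_cst|exact: fi].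
  by apply/funext => x; rewrite cReM.
- rewrite (_ : (fun x => _) = fun x => Re c * Im (f x) + Im c * Re (f x)).
    by move=> x; apply: cvgD; apply: cvgM; [exact: cvg_cst|exact: fi|exact: cvg_cst|exact: fr].
  by apply/funext => x; rewrite cImM.
- exists (`|Re c| * M + `|Im c| * M) => x; have [h1 h2] := fM x.
  rewrite cReM cImM; split.
    by rewrite (le_trans (ler_normB _ _))// !normrM lerD// ler_wpM2l.
  by rewrite (le_trans (ler_normD _ _))// !normrM lerD// ler_wpM2l.
Qed.

Lemma cts_bounded_sum n (f : 'I_n -> R -> R[i]) :
  (forall i, cts_bounded (f i)) -> cts_bounded (fun x => \sum_i f i x).
Proof.
move=> ft; split.
- rewrite (_ : (fun x => _) = fun x => \sum_i Re (f i x)).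
    by move=> x; apply: cvg_sum => i; have [h _ _] := ft i; exact: h.
  by apply/funext => x; rewrite Re_sum.
- rewrite (_ : (fun x => _) = fun x => \sum_i Im (f i x)).
    by move=> x; apply: cvg_sum => i; have [_ h _] := ft i; exact: h.
  by apply/funext => x; rewrite Im_sum.
- have [M MP] : {M : 'I_n -> R & forall i x,
      `|Re (f i x)| <= M i /\ `|Im (f i x)| <= M i}.
    apply: (@choice _ _ (fun i M => forall x,
      `|Re (f i x)| <= M /\ `|Im (f i x)| <= M)) => i.
    by have [] := ft i.
  exists (\sum_i M i) => x; rewrite Re_sum Im_sum.
  by split; rewrite (le_trans (ler_norm_sum _ _ _))// ler_sum// => i _;
    have [] := MP i x.
Qed.

Definition normc2 z : R := Re z ^+ 2 + Im z ^+ 2.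
Definition rdot z w : R := Re z * Re w + Im z * Im w.

Lemma normc2_ge0 z : 0 <= normc2 z.
Proof. by rewrite addr_ge0// sqr_ge0. Qed.

Lemma normc2_eq0 z : normc2 z = 0 -> z = 0.
Proof.
move/eqP; rewrite paddr_eq0 ?sqr_ge0// !sqrf_eq0 => /andP[/eqP r0 /eqP i0].
exact: complex_ext.
Qed.

End ComplexCoordinates.

(** * Dichotomy for complex systems *)

Section ComplexDichotomy.
Variables (R : realType) (n : nat).
Implicit Types (A : R -> 'M[R[i]]_n) (Y : R -> 'cV[R[i]]_n) (T : 'M[R[i]]_n).
Implicit Types (sg : 'I_n -> bool) (F : set_system R).

Definition csolution A Y :=
  forall x i, is_cderive (fun y => Y y i 0) x ((A x *m Y x) i 0).

Definition cvanishes F Y := forall i, ccvg F (fun x => Y x i 0) 0.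

Definition continuous_bounded A := forall i j, cts_bounded (fun x => A x i j).

Definition cform T sg (cu cs : R) (Y : 'cV[R[i]]_n) : R :=
  \sum_i signed sg cu cs i * normc2 ((T *m Y) i 0).

(** T passes to the coordinates in which the leading part is diagonal. *)
Definition cenergy_growth T sg A (delta : R) := forall cu cs, 1 <= cu <= 2 ->
  1 <= cs <= 2 -> forall x (Y : 'cV[R[i]]_n),
  delta * \sum_i normc2 ((T *m Y) i 0) <=
    \sum_i signed sg cu cs i * rdot ((T *m Y) i 0) ((T *m (A x *m Y)) i 0).

(** Complex n-vectors are treated as real vectors of size n + n, with the real
parts first. *)
Definition stack (w : 'I_n -> R[i]) (k : 'I_(n + n)) : R :=
  match fintype.split k with inl i => Re (w i) | inr i => Im (w i) end.

Definition unstack (v : 'I_(n + n) -> R) (i : 'I_n) : R[i] :=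
  v (lshift n i) +i* v (rshift n i).

Definition base (k : 'I_(n + n)) : 'I_n :=
  match fintype.split k with inl i => i | inr i => i end.

Definition real_coefs (B : R -> 'M[R[i]]_n) (k l : 'I_(n + n)) (x : R) : R :=
  match fintype.split k, fintype.split l with
  | inl i, inl j => Re (B x i j)
  | inl i, inr j => - Im (B x i j)
  | inr i, inl j => Im (B x i j)
  | inr i, inr j => Re (B x i j)
  end.

Let splitL (i : 'I_n) : fintype.split (lshift n i) = inl i. Proof. exact: (unsplitK (inl i)). Qed.
Let splitR (i : 'I_n) : fintype.split (rshift n i) = inr i. Proof. exact: (unsplitK (inr i)). Qed.

Lemma stack_lshift w i : stack w (lshift n i) = Re (w i).
Proof. by rewrite /stack splitL. Qed.
Lemma stack_rshift w i : stack w (rshift n i) = Im (w i).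
Proof. by rewrite /stack splitR. Qed.

Lemma unstackK v : stack (unstack v) =1 v.
Proof.
by move=> k; rewrite -[k]splitK; case: (fintype.split k) => i /=;
  rewrite ?stack_lshift ?stack_rshift.
Qed.

Lemma stack_mulmx (B : R -> 'M[R[i]]_n) (W : 'cV[R[i]]_n) x k :
  stack (fun i => (B x *m W) i 0) k =
  \sum_l real_coefs B k l x * stack (fun i => W i 0) l.
Proof.
rewrite big_split_ord -[k]splitK; case: (fintype.split k) => i /=.
  rewrite stack_lshift mxE Re_sum -big_split/=; apply: eq_bigr => j _.
  by rewrite stack_lshift stack_rshift /real_coefs !(splitL, splitR) cReM mulNr.
rewrite stack_rshift mxE Im_sum -big_split/=; apply: eq_bigr => j _.
by rewrite stack_lshift stack_rshift /real_coefs !(splitL, splitR) cImM addrC.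
Qed.

Lemma sum_stack (c : 'I_n -> R) (w z : 'I_n -> R[i]) :
  \sum_k c (base k) * (stack w k * stack z k) = \sum_i c i * rdot (w i) (z i).
Proof.
rewrite big_split_ord/= -big_split/=; apply: eq_bigr => i _.
by rewrite !stack_lshift !stack_rshift /base splitL splitR -mulrDr.
Qed.

Lemma sum_stack2 (c : 'I_n -> R) (w : 'I_n -> R[i]) :
  \sum_k c (base k) * stack w k ^+ 2 = \sum_i c i * normc2 (w i).
Proof.
under eq_bigr do rewrite expr2.
by rewrite sum_stack; apply: eq_bigr => i _; rewrite /normc2 !expr2.
Qed.

Variables (T : 'M[R[i]]_n) (sg : 'I_n -> bool) (A : R -> 'M[R[i]]_n) (delta : R).
Hypothesis Tu : T \in unitmx.
Hypothesis delta_gt0 : 0 < delta.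
Hypothesis Acb : continuous_bounded A.
Hypothesis Aeg : cenergy_growth T sg A delta.

Let B x := T *m A x *m invmx T.
Let sgR (k : 'I_(n + n)) := sg (base k).
Let a := real_coefs B.

Let realify Y k x := stack (fun i => (T *m Y x) i 0) k.
Let complexify (y : 'I_(n + n) -> R -> R) x : 'cV[R[i]]_n :=
  invmx T *m \col_i unstack (y^~ x) i.

Let realify_solution Y : csolution A Y -> solution a (realify Y).
Proof.
move=> Ys k x.
rewrite (_ : vfield _ _ _ _ = stack (fun i => (T *m (A x *m Y x)) i 0) k); last first.
  rewrite /vfield /a -stack_mulmx; congr (stack _ k); apply/funext => i.
  by rewrite /B -!mulmxA mulKmx.
have h i := is_cderive_mulmx T i (Ys x).
rewrite /realify; rewrite -[k]splitK; case: (fintype.split k) => i /=.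
  rewrite stack_lshift; under eq_fun do rewrite stack_lshift.
  exact: (h i).1.
rewrite stack_rshift; under eq_fun do rewrite stack_rshift.
exact: (h i).2.
Qed.

Let complexify_solution y : solution a y -> csolution A (complexify y).
Proof.
move=> ys x i; pose W z := \col_j unstack (y^~ z) j.
have Wd j : is_cderive (fun z => W z j 0) x ((B x *m W x) j 0).
  have e k : stack (fun i => (B x *m W x) i 0) k = vfield a y k x.
    rewrite stack_mulmx; apply: eq_bigr => l _; congr (_ * _).
    rewrite -[RHS](unstackK (y^~ x)); congr (stack _ l).
    by apply/funext => m; rewrite mxE.
  split.
    rewrite -(stack_lshift (fun i => (B x *m W x) i 0)) e (_ : (fun z => _) = y (lshift n j)); first exact: ys.
    by apply/funext => z; rewrite mxE.
  rewrite -(stack_rshift (fun i => (B x *m W x) i 0)) e (_ : (fun z => _) = y (rshift n j)); first exact: ys.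
  by apply/funext => z; rewrite mxE.
have -> : A x *m complexify y x = invmx T *m (B x *m W x).
  by rewrite /B /complexify -/(W x) -!mulmxA mulKmx.
exact: is_cderive_mulmx.
Qed.

Let realify_vanishes F {FF : Filter F} Y : cvanishes F Y -> vanishes F (realify Y).
Proof.
move=> Yv k; have h i : ccvg F (fun x => (T *m Y x) i 0) 0.
  rewrite [X in ccvg _ _ X](_ : _ = (T *m (0 : 'cV[R[i]]_n)) i 0); last by rewrite mulmx0 mxE.
  by apply: ccvg_mulmx => j; rewrite mxE; exact: Yv.
rewrite /realify -[k]splitK; case: (fintype.split k) => i /=.
  by under eq_cvg do rewrite stack_lshift; exact: (h i).1.
by under eq_cvg do rewrite stack_rshift; exact: (h i).2.
Qed.

Let complexify_vanishes F {FF : Filter F} y : vanishes F y -> cvanishes F (complexify y).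
Proof.
move=> yv i; rewrite [X in ccvg _ _ X](_ : _ = (invmx T *m (0 : 'cV[R[i]]_n)) i 0); last by rewrite mulmx0 mxE.
apply: ccvg_mulmx => j; rewrite mxE; split.
  by under eq_cvg do rewrite mxE; exact: yv.
by under eq_cvg do rewrite mxE; exact: yv.
Qed.

Let cform_realify cu cs Y x :
  wform (signed sgR cu cs) (realify Y) x = cform T sg cu cs (Y x).
Proof. exact: (sum_stack2 (signed sg cu cs)). Qed.

Let a_growth : energy_growth sgR a delta.
Proof.
move=> cu cs cu12 cs12 x v.
have [Y TY] : exists Y : 'cV[R[i]]_n, forall i, (T *m Y) i 0 = unstack v i.
  by exists (invmx T *m \col_i unstack v i) => i; rewrite mulKVmx// mxE.
have ev k : v k = stack (fun i => (T *m Y) i 0) k.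
  by rewrite -[LHS]unstackK; congr (stack _ k); apply/funext => i; rewrite TY.
have := Aeg cu12 cs12 x Y.
rewrite (_ : \sum_i normc2 _ = \sum_i v i ^+ 2); last first.
  transitivity (\sum_i 1 * normc2 ((T *m Y) i 0)).
    by apply: eq_bigr => i _; rewrite mul1r.
  rewrite -(sum_stack2 (fun=> 1)); apply: eq_bigr => k _.
  by rewrite mul1r -ev.
have e2 k : stack (fun i => (T *m (A x *m Y)) i 0) k = \sum_l a k l x * v l.
  have -> : T *m (A x *m Y) = B x *m (T *m Y) by rewrite /B -!mulmxA mulKmx.
  by rewrite stack_mulmx; apply: eq_bigr => l _; rewrite -ev.
move=> /le_trans; apply; rewrite -sum_stack le_eqVlt; apply/orP; left; apply/eqP.
by apply: eq_bigr => k _; rewrite (e2 k) -(ev k).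
Qed.

Let B_cb : continuous_bounded B.
Proof.
move=> i j.
rewrite (_ : (fun x => _) = fun x => \sum_k invmx T k j * (\sum_l T i l * A x l k)).
  by do 2![apply: cts_bounded_sum => ?; apply: cts_bounded_scale]; exact: Acb.
apply/funext => x; rewrite /B mxE; apply: eq_bigr => k _.
by rewrite mulrC mxE.
Qed.

Let a_continuous k l : continuous (a k l).
Proof.
move=> x; rewrite /a /real_coefs; case: (fintype.split k) => i; case: (fintype.split l) => j;
  have [Bre Bim _] := B_cb i j; [exact: Bre|apply: cvgN; exact: Bim|exact: Bim|exact: Bre].
Qed.

Let a_bounded : bounded_coefs a.
Proof.
have [M MP] : {M : 'I_n * 'I_n -> R & forall ij x,
    `|Re (B x ij.1 ij.2)| <= M ij /\ `|Im (B x ij.1 ij.2)| <= M ij}.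
  apply: (@choice _ _ (fun ij M => forall x,
    `|Re (B x ij.1 ij.2)| <= M /\ `|Im (B x ij.1 ij.2)| <= M)) => ij.
  by have [] := B_cb ij.1 ij.2.
have M0 ij : 0 <= M ij by apply: le_trans (normr_ge0 _) (MP ij 0).1.
exists (\sum_ij M ij) => k l x.
have h ij : M ij <= \sum_ij M ij.
  by rewrite (bigD1 ij)//= lerDl sumr_ge0.
rewrite /a /real_coefs; case: (fintype.split k) => i; case: (fintype.split l) => j;
  rewrite ?normrN; apply: le_trans (h (i, j)).
- exact: (MP (i, j) x).1.
- exact: (MP (i, j) x).2.
- exact: (MP (i, j) x).2.
- exact: (MP (i, j) x).1.
Qed.

Let realify_eq0 Y x : (forall k, realify Y k x = 0) -> Y x = 0.
Proof.
move=> rx; apply: (can_inj (mulKmx Tu)); rewrite mulmx0.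
apply/colP => i; rewrite [RHS]mxE; apply: complex_ext.
  by rewrite -(stack_lshift (fun i => (T *m Y x) i 0)); exact: rx.
by rewrite -(stack_rshift (fun i => (T *m Y x) i 0)); exact: rx.
Qed.

Lemma csolution_unique0 Y : csolution A Y -> Y 0 = 0 -> forall x, Y x = 0.
Proof.
move=> Ys Y0 x; have := solution_unique0 a_bounded (realify_solution Ys) (x0 := 0).
have r0 k : realify Y k 0 = 0.
  by rewrite /realify Y0 mulmx0 /stack; case: fintype.split => i; rewrite mxE.
move=> /(_ r0) rx; apply: realify_eq0 => k; exact: rx.
Qed.

Lemma cform_of_vanishing Y : csolution A Y -> cvanishes +oo Y ->
  cform T sg 1 1 (Y 0) <= 0 /\ (cform T sg 1 1 (Y 0) = 0 -> Y 0 = 0).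
Proof.
move=> Ys Yv; rewrite -cform_realify.
have [le0 eq0] := energy_of_vanishing delta_gt0 a_growth (realify_solution Ys)
  (realify_vanishes Yv).
by split=> // e; apply: realify_eq0; exact: eq0.
Qed.

Lemma cform_of_vanishingN Y : csolution A Y -> cvanishes -oo Y ->
  0 <= cform T sg 1 1 (Y 0) /\ (cform T sg 1 1 (Y 0) = 0 -> Y 0 = 0).
Proof.
move=> Ys Yv; rewrite -cform_realify.
have [le0 eq0] := energy_of_vanishingN delta_gt0 a_growth (realify_solution Ys)
  (realify_vanishes Yv).
by split=> // e; apply: realify_eq0; exact: eq0.
Qed.

Let component_complexify y (w : 'I_n -> R[i]) i :
  (forall k, base k = i -> y k 0 = stack w k) -> (T *m complexify y 0) i 0 = w i.
Proof.
move=> yw; rewrite /complexify mulKVmx// mxE; apply: complex_ext => /=.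
  by rewrite yw ?stack_lshift// /base splitL.
by rewrite yw ?stack_rshift// /base splitR.
Qed.

Lemma exists_cvanishing (w : 'I_n -> R[i]) : exists Y,
  [/\ csolution A Y, cvanishes +oo Y & forall i, ~~ sg i -> (T *m Y 0) i 0 = w i].
Proof.
have [y [ys yv y0]] := exists_vanishing (stack w) delta_gt0 a_continuous a_bounded a_growth.
exists (complexify y); split=> [||i si]; [exact: complexify_solution|exact: complexify_vanishes|].
by apply: component_complexify => k ki; apply: y0; rewrite /sgR ki.
Qed.

Lemma exists_cvanishingN (w : 'I_n -> R[i]) : exists Y,
  [/\ csolution A Y, cvanishes -oo Y & forall i, sg i -> (T *m Y 0) i 0 = w i].
Proof.
have [y [ys yv y0]] := exists_vanishingN (stack w) delta_gt0 a_continuous a_bounded a_growth.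
exists (complexify y); split=> [||i si]; [exact: complexify_solution|exact: complexify_vanishes|].
by apply: component_complexify => k ki; apply: y0; rewrite /sgR ki.
Qed.

End ComplexDichotomy.

(** * Bases of decaying solutions and their transversality *)

Section EvansBases.
Variable R : realType.
Implicit Types (A : R -> 'M[R[i]]_4) (Y : R -> 'cV[R[i]]_4) (T : 'M[R[i]]_4).
Implicit Types (F : set_system R).

Lemma is_cderive_comb (a b : R[i]) (f g : R -> R[i]) (d e : R[i]) (x : R) :
  is_cderive f x d -> is_cderive g x e ->
  is_cderive (fun y => a * f y + b * g y) x (a * d + b * e).
Proof.
move=> fd ge; have [f1 f2] := is_cderive_scale a fd.
have [g1 g2] := is_cderive_scale b ge; split.
  rewrite cReD (_ : (fun y => _) = fun y => Re (a * f y) + Re (b * g y)).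
    exact: deriv_add.
  by apply/funext => y; rewrite cReD.
rewrite cImD (_ : (fun y => _) = fun y => Im (a * f y) + Im (b * g y)).
  exact: deriv_add.
by apply/funext => y; rewrite cImD.
Qed.

Lemma ccvg_comb F (FF : Filter F) (a b : R[i]) (f g : R -> R[i]) (d e : R[i]) :
  ccvg F f d -> ccvg F g e ->
  ccvg F (fun y => a * f y + b * g y) (a * d + b * e).
Proof.
move=> fd ge; have [f1 f2] := ccvgM FF (ccvg_cst FF a) fd.
have [g1 g2] := ccvgM FF (ccvg_cst FF b) ge; split.
  by rewrite cReD; under eq_cvg do rewrite cReD; exact: cvgD.
by rewrite cImD; under eq_cvg do rewrite cImD; exact: cvgD.
Qed.

Lemma decaying_comb A F (FF : Filter F) Y1 Y2 (a b : R[i]) :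
  decaying_solution A F Y1 -> decaying_solution A F Y2 ->
  decaying_solution A F (fun x => a *: Y1 x + b *: Y2 x).
Proof.
move=> [s1 v1] [s2 v2]; split=> [x i|i].
  rewrite mulmxDr -!scalemxAr !mxE (_ : (fun y => _) = fun y => a * Y1 y i 0 + b * Y2 y i 0).
    by have := is_cderive_comb a b (s1 x i) (s2 x i); rewrite !mxE.
  by apply/funext => y; rewrite !mxE.
rewrite (_ : (fun y => _) = fun y => a * Y1 y i 0 + b * Y2 y i 0).
  have h := ccvg_comb FF a b (v1 i) (v2 i); rewrite !mulr0 addr0 in h.
  exact: h.
by apply/funext => y; rewrite !mxE.
Qed.

(** Solutions decaying along F are parametrised by two of their coordinates at
time 0. *)
Lemma decaying_basis_exists T A F (FF : Filter F) (i1 i2 : 'I_4) : i1 != i2 ->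
  (forall w : 'I_4 -> R[i], exists Y, decaying_solution A F Y /\
     (T *m Y 0) i1 0 = w i1 /\ (T *m Y 0) i2 0 = w i2) ->
  (forall Y, decaying_solution A F Y ->
     (T *m Y 0) i1 0 = 0 -> (T *m Y 0) i2 0 = 0 -> forall x, Y x = 0) ->
  exists Y1 Y2, decaying_basis A F Y1 Y2.
Proof.
move=> i12 ex inj.
have [Y1 [Y1d [Y11 Y12]]] := ex (fun i => (i == i1)%:R).
have [Y2 [Y2d [Y21 Y22]]] := ex (fun i => (i == i2)%:R).
rewrite eqxx eq_sym (negPf i12) in Y11 Y12.
rewrite eqxx (negPf i12) in Y21 Y22.
have comb a b (i : 'I_4) : (T *m (a *: Y1 0 + b *: Y2 0)) i 0 =
    a * (T *m Y1 0) i 0 + b * (T *m Y2 0) i 0.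
  by rewrite mulmxDr -!scalemxAr !mxE.
exists Y1, Y2; split => // [a b ab0|Y Yd].
  have h i : a * (T *m Y1 0) i 0 + b * (T *m Y2 0) i 0 = 0.
    by rewrite -comb ab0 mulmx0 mxE.
  have := h i1; have := h i2.
  by rewrite Y11 Y12 Y21 Y22 !mulr0 !mulr1 addr0 add0r => -> ->.
pose a := (T *m Y 0) i1 0; pose b := (T *m Y 0) i2 0.
exists a, b => x; apply/eqP; rewrite -subr_eq0; apply/eqP.
have Dd := decaying_comb FF 1 (-1) Yd (decaying_comb FF a b Y1d Y2d).
have e (i : 'I_4) : (T *m (1 *: Y 0 + (-1) *: (a *: Y1 0 + b *: Y2 0))) i 0 =
    (T *m Y 0) i 0 - (a * (T *m Y1 0) i 0 + b * (T *m Y2 0) i 0).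
  by rewrite -comb scale1r scaleN1r mulmxBr !mxE.
have := inj _ Dd; rewrite !e Y11 Y12 Y21 Y22 !mulr0 !mulr1 addr0 add0r !subrr.
by move=> /(_ erefl erefl x); rewrite scale1r scaleN1r.
Qed.

(** The roots come in the order A, B, -A, -B. *)
Definition sg4 (i : 'I_4) : bool := (i < 2)%N.

Variables (T : 'M[R[i]]_4) (A : R -> 'M[R[i]]_4) (delta : R).
Hypothesis Tu : T \in unitmx.
Hypothesis delta_gt0 : 0 < delta.
Hypothesis Acb : continuous_bounded A.
Hypothesis Aeg : cenergy_growth T sg4 A delta.

Let cformE (Y : 'cV[R[i]]_4) : cform T sg4 1 1 Y =
  normc2 ((T *m Y) 0 0) + normc2 ((T *m Y) 1 0)
  - (normc2 ((T *m Y) 2%:R 0) + normc2 ((T *m Y) 3%:R 0)).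
Proof.
rewrite /cform !big_ord_recr big_ord0/= add0r /signed /sg4/=.
rewrite !mul1r !mulN1r [in RHS]opprD [in RHS]addrA.
congr (normc2 _ + normc2 _ - normc2 _ - normc2 _); congr ((T *m Y) _ 0);
  exact/val_inj.
Qed.

Lemma decaying_basis_plus : exists Y1 Y2, decaying_basis A +oo Y1 Y2.
Proof.
apply: (@decaying_basis_exists T A _ _ 2%:R 3%:R) => // [w|Y [Ys Yv] e2 e3].
  have [Y [Ys Yv Yw]] := exists_cvanishing Tu delta_gt0 Acb Aeg w.
  by exists Y; split=> //; split; exact: Yw.
have [le0 eq0] := cform_of_vanishing Tu delta_gt0 Aeg Ys Yv.
apply: (csolution_unique0 Tu Acb (Y := Y) Ys); apply: eq0; apply/eqP; rewrite eq_le le0.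
rewrite cformE e2 e3 /normc2 /= !expr0n/= !addr0 subr0.
by rewrite !addr_ge0 ?sqr_ge0.
Qed.

Lemma decaying_basis_minus : exists Y1 Y2, decaying_basis A -oo Y1 Y2.
Proof.
apply: (@decaying_basis_exists T A _ _ 0 1) => // [w|Y [Ys Yv] e2 e3].
  have [Y [Ys Yv Yw]] := exists_cvanishingN Tu delta_gt0 Acb Aeg w.
  by exists Y; split=> //; split; exact: Yw.
have [le0 eq0] := cform_of_vanishingN Tu delta_gt0 Aeg Ys Yv.
apply: (csolution_unique0 Tu Acb (Y := Y) Ys); apply: eq0; apply/eqP; rewrite eq_le le0 andbT.
rewrite cformE e2 e3 /normc2 /= !expr0n/= !addr0 add0r oppr_le0.
by rewrite !addr_ge0 ?sqr_ge0.
Qed.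

(** A linear relation between the four columns yields a solution decaying at -oo
and a solution decaying at +oo that agree at time 0. The form is nonnegative
there by the former property and nonpositive by the latter, so both solutions
vanish. *)
Lemma evans_det_neq0 Y1m Y2m Y1p Y2p :
  decaying_basis A -oo Y1m Y2m -> decaying_basis A +oo Y1p Y2p ->
  \det (row_mx (row_mx (Y1m 0) (Y2m 0)) (row_mx (Y1p 0) (Y2p 0)) : 'M[R[i]]_4) <> 0.
Proof.
move=> [m1 m2 mfree _] [p1 p2 pfree _].
set M := row_mx _ _; rewrite -det_tr => /eqP /det0P [v v0].
move=> /(congr1 trmx); rewrite trmx0 trmx_mul trmxK.
have {v0} : v^T != 0 by apply: contra_neq v0 => vt; rewrite -[v]trmxK vt trmx0.
move: (v^T) => w w0 Mw.
have {Mw} : (M : 'M[R[i]]_(4, 1 + 1 + (1 + 1))) *m (w : 'cV[R[i]]_(1 + 1 + (1 + 1))) = 0 by [].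
have {w0} : (w : 'cV[R[i]]_(1 + 1 + (1 + 1))) != 0 by [].
move: (w : 'cV[R[i]]_(1 + 1 + (1 + 1))) => {w} w w0.
rewrite -[w]vsubmxK -[usubmx w]vsubmxK -[dsubmx w]vsubmxK.
set a := usubmx (usubmx _); set b := dsubmx (usubmx _).
set c := usubmx (dsubmx _); set d := dsubmx (dsubmx _).
rewrite /M !mul_row_col.
rewrite [a]mx11_scalar [b]mx11_scalar [c]mx11_scalar [d]mx11_scalar.
rewrite !mul_mx_scalar => sum0.
pose Zm x := a 0 0 *: Y1m x + b 0 0 *: Y2m x.
pose Zp x := - c 0 0 *: Y1p x + - d 0 0 *: Y2p x.
have [Zms Zmv] : decaying_solution A -oo Zm by exact: decaying_comb.
have [Zps Zpv] : decaying_solution A +oo Zp by exact: decaying_comb.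
have e0 : Zm 0 = Zp 0.
  by apply/eqP; rewrite -subr_eq0 /Zm /Zp opprD !scaleNr !opprK sum0.
have [ge0 eq0] := cform_of_vanishingN Tu delta_gt0 Aeg (Y := Zm) Zms Zmv.
have [le0 eq0'] := cform_of_vanishing Tu delta_gt0 Aeg (Y := Zp) Zps Zpv.
have f0 : cform T sg4 1 1 (Zm 0) = 0 by apply/eqP; rewrite eq_le ge0 andbT e0.
have f0' : cform T sg4 1 1 (Zp 0) = 0 by rewrite -e0.
have [a0 b0] := mfree _ _ (csolution_unique0 Tu Acb (Y := Zm) Zms (eq0 f0)).
have [c0 d0] := pfree _ _ (csolution_unique0 Tu Acb (Y := Zp) Zps (eq0' f0')).
move/eqP: w0; apply.
rewrite -[w]vsubmxK -[usubmx w]vsubmxK -[dsubmx w]vsubmxK.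
rewrite -/a -/b -/c -/d [a]mx11_scalar [b]mx11_scalar [c]mx11_scalar [d]mx11_scalar.
move/eqP: c0; rewrite oppr_eq0 => /eqP ->; move/eqP: d0; rewrite oppr_eq0 => /eqP ->.
by rewrite a0 b0 !raddf0 !col_mx0.
Qed.

End EvansBases.

(** * Smooth functions whose derivatives have limits at both infinities *)

Section Tame.
Variable R : realType.
Implicit Types f g : R -> R.

Definition has_limits f :=
  (exists l : R, f x @[x --> +oo] --> l) /\ (exists l : R, f x @[x --> -oo] --> l).

(** Only the existence of the limits is recorded, not that those of the
derivatives are 0: this is what is stable under products and powers, and what
the limit matrices need. *)
Fixpoint tameN n f : Prop := [/\ continuous f, has_limits f &
  if n is n'.+1 then (forall x : R, derivable f x 1) /\ tameN n' (derive1 f) else True].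

Definition tame f := forall n, tameN n f.

Lemma derive1_eq f df : (forall x : R, is_derive x 1 f (df x)) -> derive1 f = df.
Proof.
by move=> fd; apply/funext => x; rewrite derive1E; have [_ ->] := fd x.
Qed.

Lemma derivable_is_derive f : (forall x : R, derivable f x 1) ->
  forall x : R, is_derive x 1 f (derive1 f x).
Proof. by move=> fd x; rewrite derive1E; exact/derivableP. Qed.

Lemma tameN_intro n f df : (forall x : R, is_derive x 1 f (df x)) ->
  has_limits f -> tameN n df -> tameN n.+1 f.
Proof.
move=> fd fl dft; split=> //; first exact: is_derive_continuous fd.
by split=> [x|]; [have [] := fd x|rewrite (derive1_eq fd)].
Qed.

Lemma tameN_pred n f : tameN n.+1 f -> tameN n f.
Proof.
elim: n f => [|n IH] f [fc fl [fd dft]]; first by split.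
by split=> //; split=> //; exact: IH.
Qed.

Lemma tameN_derive n f : tameN n.+1 f ->
  (forall x : R, is_derive x 1 f (derive1 f x)) /\ tameN n (derive1 f).
Proof. by move=> [_ _ [fd dft]]; split=> //; exact: derivable_is_derive. Qed.

Lemma tameN_limits n f : tameN n f -> continuous f /\ has_limits f.
Proof. by case: n => [|n] []. Qed.

Lemma tame_derive f : tame f -> tame (derive1 f).
Proof. by move=> ft n; have [_ _ []] := ft n.+1. Qed.

Lemma tame_cst (c : R) : tame (fun=> c).
Proof.
suff h n : forall c : R, tameN n (fun=> c) by move=> n; exact: h.
have lim (d : R) : has_limits (fun=> d) by split; exists d; exact: cvg_cst.
elim: n => [|n IH] d; first by split=> // x; exact: cvg_cst.
by apply: (@tameN_intro _ _ (fun=> 0)).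
Qed.

Lemma has_limitsD f g : has_limits f -> has_limits g -> has_limits (fun x => f x + g x).
Proof.
by move=> [[l1 h1] [l2 h2]] [[k1 h3] [k2 h4]]; split;
  [exists (l1 + k1)|exists (l2 + k2)]; exact: cvgD.
Qed.

Lemma has_limitsM f g : has_limits f -> has_limits g -> has_limits (fun x => f x * g x).
Proof.
by move=> [[l1 h1] [l2 h2]] [[k1 h3] [k2 h4]]; split;
  [exists (l1 * k1)|exists (l2 * k2)]; exact: cvgM.
Qed.

Lemma tameND n f g : tameN n f -> tameN n g -> tameN n (fun x => f x + g x).
Proof.
elim: n f g => [|n IH] f g ft gt.
  have [fc fl] := tameN_limits ft; have [gc gl] := tameN_limits gt.
  split=> //; last exact: has_limitsD.
  by move=> x; apply: cvgD; [exact: fc|exact: gc].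
have [fd dft] := tameN_derive ft; have [gd dgt] := tameN_derive gt.
apply: (tameN_intro (fun x => deriv_add (fd x) (gd x))).
- by apply: has_limitsD; [exact: (tameN_limits ft).2|exact: (tameN_limits gt).2].
- exact: IH.
Qed.

Lemma tameNM n f g : tameN n f -> tameN n g -> tameN n (fun x => f x * g x).
Proof.
elim: n f g => [|n IH] f g ft gt.
  have [fc fl] := tameN_limits ft; have [gc gl] := tameN_limits gt.
  split=> //; last exact: has_limitsM.
  by move=> x; apply: cvgM; [exact: fc|exact: gc].
have [fd dft] := tameN_derive ft; have [gd dgt] := tameN_derive gt.
apply: (tameN_intro (fun x => deriv_mul (fd x) (gd x))).
- by apply: has_limitsM; [exact: (tameN_limits ft).2|exact: (tameN_limits gt).2].
- by apply: tameND; apply: IH => //; exact: tameN_pred.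
Qed.

Lemma tameD f g : tame f -> tame g -> tame (fun x => f x + g x).
Proof. by move=> ft gt n; exact: tameND. Qed.

Lemma tameM f g : tame f -> tame g -> tame (fun x => f x * g x).
Proof. by move=> ft gt n; exact: tameNM. Qed.

Lemma tame_opp f : tame f -> tame (fun x => - f x).
Proof.
move=> ft; rewrite (_ : (fun x => _) = fun x => -1 * f x).
  by apply: tameM => //; exact: tame_cst.
by apply/funext => x; rewrite mulN1r.
Qed.

Lemma tame_sqr f : tame f -> tame (fun x => f x ^+ 2).
Proof.
move=> ft; rewrite (_ : (fun x => _) = fun x => f x * f x); first exact: tameM.
by apply/funext => x; rewrite expr2.
Qed.

Definition positive_with_limits f := (forall x, 0 < f x) /\
  (exists l : R, 0 < l /\ f x @[x --> +oo] --> l) /\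
  (exists l : R, 0 < l /\ f x @[x --> -oo] --> l).

(** The induction is on the order of differentiation, for all exponents at once,
as differentiating lowers the exponent. *)
Lemma tame_powR f (a : R) : tame f -> positive_with_limits f ->
  tame (fun x => f x `^ a).
Proof.
move=> ft [f0 [[l [l0 fl]] [m [m0 fm]]]].
have cp (b x : R) : 0 < x -> {for x, continuous (fun y => y `^ b)}.
  move=> x0; apply/differentiable_continuous/derivable1_diffP.
  by have [] := is_derive1_powR b x0.
have lim b : has_limits (fun x => f x `^ b).
  split; [exists (l `^ b)|exists (m `^ b)].
    by exact: (@cvg_comp _ _ _ f (fun y => y `^ b) _ _ _ fl (cp b l l0)).
  by exact: (@cvg_comp _ _ _ f (fun y => y `^ b) _ _ _ fm (cp b m m0)).
suff h n : forall b, tameN n (fun x => f x `^ b) by move=> n; exact: h.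
elim: n => [|n IH] b.
  split=> // x; apply: (@continuous_comp _ _ _ f (fun y => y `^ b)); last exact: cp.
  by have [fc _ _] := ft 0%N; exact: fc.
have [fd dft] := tameN_derive (ft n.+1).
have pd (x : R) : is_derive x 1 (fun x => f x `^ b) (b * f x `^ (b - 1) * derive1 f x).
  have h := is_derive1_powR b (f0 x).
  exact: (@is_derive1_comp _ (fun y => y `^ b) f x _ _ h (fd x)).
apply: (tameN_intro pd) => //.
by apply: tameNM => //; apply: tameNM => //; exact: tame_cst.
Qed.

Lemma tame_inv f : tame f -> positive_with_limits f -> tame (fun x => (f x)^-1).
Proof.
move=> ft f0; rewrite (_ : (fun x => _) = fun x => f x `^ (-1)).
  exact: tame_powR.
by apply/funext => x; rewrite powR_inv1// ltW//; exact: f0.1.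
Qed.

Lemma tame_bounded f : tame f -> exists2 M : R, 0 <= M & forall x, `|f x| <= M.
Proof.
move=> /(_ 0%N) [fc [[l fl] [m fm]] _].
have [a [_ fa]] := cvgr_dist_le _ _ fl _ ltr01.
have [b [_ fb]] := cvgr_dist_le _ _ fm _ ltr01.
pose c := Num.min a b - 1; pose d := Num.max a b + 1.
have cd : c <= d.
  rewrite /c /d lerBlDr -addrA (@le_trans _ _ a)// ?ge_min ?lexx//.
  by rewrite (@le_trans _ _ (Num.max a b))// ?le_max ?lexx// lerDl.
have nc : {within `[c, d], continuous (fun x => `|f x|)}.
  apply: continuous_subspaceT => x; apply: (@continuous_comp _ _ _ f Num.norm); first exact: fc.
  exact: norm_continuous.
have [z _ zP] := EVT_max cd nc.
have z0 := normr_ge0 (f z).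
exists (`|f z| + (`|l| + 1) + (`|m| + 1)).
  by rewrite !addr_ge0.
have tri (t k : R) : `|k - t| <= 1 -> `|t| <= `|k| + 1 :> R.
  by move=> h; rewrite -lerBlDl (le_trans (lerB_dist _ _))// distrC.
have l0 := normr_ge0 l; have m0 := normr_ge0 m.
move=> x; have [ax|xa] := ltP a x; first by have := tri _ _ (fa _ ax); lra.
have [xb|bx] := ltP x b; first by have := tri _ _ (fb _ xb); lra.
have := zP x; rewrite in_itv/= => h.
have {h} : `|f x| <= `|f z|.
  apply: h; apply/andP; split.
    by rewrite /c lerBlDr (le_trans _ (_ : x <= _))// ?lerDl// ge_min bx orbT.
  by rewrite /d (le_trans xa)// (@le_trans _ _ (Num.max a b))// ?le_max ?lexx// lerDl.
lra.
Qed.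

End Tame.

(** * Coefficients along a profile *)

Section Profile.
Variable R : realType.

Lemma tame_of_smooth (f : R -> R) : smooth f -> derivatives_vanish f ->
  has_limits f -> tame f.
Proof.
move=> fs fv fl; have lim m : has_limits (derive1n m f).
  by case: m => [//|m]; have [h1 h2] := fv m; split; exists 0.
suff h n : forall m, tameN n (derive1n m f) by move=> n; exact: (h n 0%N).
elim: n => [|n IH] m; split=> //.
- by move=> x; apply/differentiable_continuous/derivable1_diffP; exact: fs.
- by move=> x; apply/differentiable_continuous/derivable1_diffP; exact: fs.
- by split=> [x|]; [exact: fs|exact: (IH m.+1)].
Qed.

(** The isothermal case gamma = 1 obeys the same formula. *)
Lemma derive1_enthalpy (gamma x : R) : 0 < x ->
  derive1 (enthalpy gamma) x = gamma * x `^ (gamma - 2).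
Proof.
move=> x0; rewrite derive1E.
have [g1|g1] := eqVneq gamma 1.
  rewrite (_ : enthalpy gamma = @ln R); last by apply/funext => y; rewrite /enthalpy g1 eqxx.
  have [_ ->] := is_derive1_ln x0.
  by rewrite g1 mul1r (_ : 1 - 2 = -1 :> R) ?powR_inv1 ?ltW//; lra.
rewrite (_ : enthalpy gamma = fun y => gamma / (gamma - 1) * y `^ (gamma - 1)); last first.
  by apply/funext => y; rewrite /enthalpy (negPf g1).
have [_ ->] := deriv_scale (gamma / (gamma - 1)) (is_derive1_powR (gamma - 1) x0).
rewrite mulrA divfK ?subr_eq0//; congr (_ * _ `^ _); lra.
Qed.

Variables (gamma mu s : R) (r u : R -> R).
Hypothesis rt : tame r.
Hypothesis ut : tame u.
Hypothesis r0 : positive_with_limits r.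

Let invt : tame (fun x => (r x)^-1). Proof. exact: tame_inv. Qed.

Let powt a : tame (fun x => r x `^ a). Proof. exact: tame_powR. Qed.

Ltac tame_tac := repeat first
  [ exact: tame_cst | exact: rt | exact: ut | exact: invt | exact: powt
  | assumption
  | apply: tameD | apply: tameM | apply: tame_opp | apply: tame_sqr
  | apply: tame_derive ].

Lemma tame_f1 : tame (f1 gamma r).
Proof.
rewrite (_ : f1 gamma r = fun x => - (gamma * r x `^ (gamma - 2))); first by tame_tac.
by apply/funext => x; rewrite /f1 derive1_enthalpy//; exact: r0.1.
Qed.

Lemma tame_f2 : tame (f2 s u). Proof. by rewrite /f2; tame_tac. Qed.

Lemma tame_f6 : tame (f6 s r u). Proof. by rewrite /f6; tame_tac. Qed.

Lemma tame_f3 : tame (f3 r). Proof. by rewrite /f3; tame_tac. Qed.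

Lemma tame_f4 : tame (f4 r). Proof. by rewrite /f4; tame_tac. Qed.

Let inv2t : tame (fun x => (r x ^+ 2)^-1).
Proof.
rewrite (_ : (fun x => _) = fun x => (r x)^-1 ^+ 2); first by tame_tac.
by apply/funext => x; rewrite exprVn.
Qed.

Lemma tame_g1 : tame (g1 mu r). Proof. by rewrite /g1; tame_tac. Qed.
Lemma tame_g2 : tame (g2 mu r). Proof. by rewrite /g2; tame_tac. Qed.
Lemma tame_g3 : tame (g3 mu r u). Proof. by rewrite /g3; tame_tac. Qed.
Lemma tame_g4 : tame (g4 mu r u). Proof. by rewrite /g4; tame_tac. Qed.

Ltac tame_tac' := repeat first
  [ exact: tame_cst | exact: rt | exact: ut | exact: invt
  | exact: tame_f1 | exact: tame_f2 | exact: tame_f3 | exact: tame_f4 | exact: tame_f6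
  | exact: tame_g1 | exact: tame_g2 | exact: tame_g3 | exact: tame_g4
  | apply: tameD | apply: tameM | apply: tame_opp | apply: tame_derive ].

Lemma tame_e0 : tame (e0 mu s r u). Proof. by rewrite /e0; tame_tac'. Qed.
Lemma tame_e1 : tame (e1 gamma mu s r u). Proof. by rewrite /e1; tame_tac'. Qed.
Lemma tame_e1' : tame (e1' mu s r u). Proof. by rewrite /e1'; tame_tac'. Qed.
Lemma tame_e2 : tame (e2 gamma mu s r u). Proof. by rewrite /e2; tame_tac'. Qed.
Lemma tame_e3 : tame (e3 mu s r). Proof. by rewrite /e3; tame_tac'. Qed.

End Profile.

Lemma profile_tame (R : realType) (gamma mu s : R) (r u : R -> R) :
  traveling_wave gamma mu s r u -> [/\ tame r, tame u & positive_with_limits r].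
Proof.
move=> [[rs us] r0 [rp [rm [up [um [[rp0 rm0] rrp rrm uup uum]]]]] [rv uv] _].
split.
- by apply: tame_of_smooth => //; split; [exists rp|exists rm].
- by apply: tame_of_smooth => //; split; [exists up|exists um].
- by split=> //; split; [exists rp|exists rm].
Qed.

(** * Polar angles and the roots of the leading part *)

Section Angles.
Variable R : realType.
Implicit Types (z : R[i]) (t : R).

Lemma normc_sqrt z : normc z = Num.sqrt (normc2 z).
Proof. by case: z. Qed.

Lemma normc_ge0 z : 0 <= normc z.
Proof. by rewrite normc_sqrt sqrtr_ge0. Qed.

Lemma sqr_normc2 z : normc z ^+ 2 = normc2 z.
Proof. by rewrite normc_sqrt sqr_sqrtr ?normc2_ge0. Qed.

Lemma normc_opp z : normc (- z) = normc z.
Proof. by case: z => a b /=; rewrite !sqrrN. Qed.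

Lemma normc_eq1 z : normc2 z = 1 -> normc z = 1.
Proof. by rewrite normc_sqrt => ->; rewrite sqrtr1. Qed.

Lemma normc_expi t : normc (expi t) = 1.
Proof. by apply: normc_eq1; rewrite /normc2/= cos2Dsin2. Qed.

Lemma normc_real t : normc t%:C = `|t|.
Proof. by rewrite /= expr0n/= addr0 sqrtr_sqr. Qed.

Lemma normc_double z : normc (z + z) = 2 * normc z.
Proof.
have -> : z + z = (2 : R)%:C * z.
  by apply: complex_ext; rewrite ?cReD ?cImD ?cReM ?cImM /= mul0r; ring.
by rewrite normcM normc_real ger0_norm.
Qed.

Lemma expiD t t' : expi (t + t') = expi t * expi t'.
Proof.
by apply: complex_ext; rewrite ?cReM ?cImM /= ?cosD ?sinD// addrC.
Qed.

Lemma polar_exists (a b : R) : a ^+ 2 + b ^+ 2 = 1 ->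
  exists t, - pi < t <= pi /\ cos t = a /\ sin t = b.
Proof.
move=> ab1; have a1 : -1 <= a <= 1.
  by rewrite -ler_norml -(@ler_sqr _ `|a|) ?nnegrE// real_normK ?num_real// expr1n -ab1 lerDl sqr_ge0.
have sb : Num.sqrt (1 - a ^+ 2) = `|b|.
  by rewrite -sqrtr_sqr; congr Num.sqrt; rewrite -ab1 addrC addKr.
have ca : cos (acos a) = a by rewrite acosK// in_itv/= a1.
have [b0|b0] := leP 0 b.
  exists (acos a); rewrite ca sin_acos// sb ger0_norm// acos_lepi// andbT.
  by split=> //; rewrite (lt_le_trans _ (acos_ge0 a1))// oppr_lt0 pi_gt0.
exists (- acos a); rewrite cosN sinN ca sin_acos// sb ltr0_norm// opprK.
split=> //; rewrite ltrN2 acos_ltpi ?(le_trans _ (pi_ge0 R)) ?oppr_le0 ?acos_ge0//.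
have [a1' a1''] := andP a1; rewrite a1'' andbT lt_neqAle a1' andbT.
apply: contraTneq b0 => a1N.
by move: ab1; rewrite -a1N sqrrN expr1n => /eqP; rewrite -subr_eq0 addrC addKr sqrf_eq0 => /eqP ->; rewrite ltxx.
Qed.

Lemma Arg_spec z : z != 0 -> - pi < Arg z <= pi /\ z = (normc z)%:C * expi (Arg z).
Proof.
move=> z0; apply: (@xgetPex _ 0 [set t | - pi < t <= pi /\ z = (normc z)%:C * expi t]).
have n0 : normc z != 0 by apply: contra_neq z0; exact: eq0_normc.
have [|t [tpi [ct st]]] := @polar_exists (Re z / normc z) (Im z / normc z).
  by rewrite !expr_div_n -mulrDl -/(normc2 z) -sqr_normc2 divff// expf_neq0.
exists t; split=> //; apply: complex_ext; rewrite ?cReM ?cImM /= ct st mul0r.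
  by rewrite subr0 mulrC divfK.
by rewrite addr0 mulrC divfK.
Qed.

Lemma Arg_cos z : z != 0 -> Re z = normc z * cos (Arg z).
Proof. by move=> /Arg_spec [_ {1}->]; rewrite cReM /= mul0r subr0. Qed.

Lemma Arg_sin z : z != 0 -> Im z = normc z * sin (Arg z).
Proof. by move=> /Arg_spec [_ {1}->]; rewrite cImM /= mul0r addr0. Qed.

Lemma normc_gt0 z : z != 0 -> 0 < normc z.
Proof.
by move=> z0; rewrite lt0r normc_ge0 andbT; apply: contra_neq z0; exact: eq0_normc.
Qed.

Lemma cos_ge0_le_pihalf t : - pi < t <= pi -> 0 <= cos t -> - (pi / 2) <= t <= pi / 2.
Proof.
move=> /andP[t1 t2] ct; apply/andP; split; rewrite leNgt; apply/negP => h.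
  have : 0 < cos (t + pi) by apply: cos_gt0_pihalf; apply/andP; split; lra.
  by rewrite cosDpi oppr_gt0 ltNge ct.
have : 0 < cos (t - pi) by apply: cos_gt0_pihalf; apply/andP; split; lra.
have -> : cos (t - pi) = - cos t by rewrite -[in RHS](subrK pi t) cosDpi opprK.
by rewrite oppr_gt0 ltNge ct.
Qed.

Variable mu : R.
Hypothesis mu0 : 0 < mu.
Hypothesis mu2 : mu < 2.

Let z1 : R[i] := (mu / 2) +i* Num.sqrt (1 - mu ^+ 2 / 4).

Let rad_gt0 : 0 < 1 - mu ^+ 2 / 4.
Proof. by have := mu0; have := mu2; nra. Qed.

Let z1_norm : normc z1 = 1.
Proof.
by apply: normc_eq1; rewrite /normc2/= sqr_sqrtr ?(ltW rad_gt0)//; field.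
Qed.

Let z1_neq0 : z1 != 0.
Proof. by apply/eqP => z0; have := z1_norm; rewrite z0 normc0 => /eqP; rewrite eq_sym oner_eq0. Qed.

Lemma cos_theta1 : cos (theta1 mu) = mu / 2.
Proof. by have := Arg_cos z1_neq0; rewrite z1_norm mul1r. Qed.

Lemma sin_theta1 : sin (theta1 mu) = Num.sqrt (1 - mu ^+ 2 / 4).
Proof. by have := Arg_sin z1_neq0; rewrite z1_norm mul1r. Qed.

Lemma sin_theta1_gt0 : 0 < sin (theta1 mu).
Proof. by rewrite sin_theta1 sqrtr_gt0 rad_gt0. Qed.

Lemma theta1_bound : 0 < theta1 mu < pi / 2.
Proof.
have [pi1 _] := Arg_spec z1_neq0.
have c0 : 0 < cos (theta1 mu) by rewrite cos_theta1 divr_gt0.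
have /andP[t1 t2] := cos_ge0_le_pihalf pi1 (ltW c0).
have pi0 := pi_gt0 R.
apply/andP; split.
  rewrite ltNge; apply/negP => t0.
  have : 0 <= sin (- theta1 mu).
    move: t0; rewrite le_eqVlt => /predU1P[->|t0]; first by rewrite oppr0 sin0.
    by apply/ltW/sin_gt0_pi; apply/andP; split; rewrite -/(theta1 mu) in t1 *; lra.
  by rewrite sinN oppr_ge0 leNgt sin_theta1_gt0.
rewrite lt_neqAle t2 andbT; apply: contraTneq c0 => e.
by rewrite e cos_pihalf ltxx.
Qed.

Lemma alpha_gt0 : 0 < alpha mu.
Proof.
rewrite /alpha/=; apply: cos_gt0_pihalf; have /andP[t1 t2] := theta1_bound.
by apply/andP; split; have := pi_gt0 R; lra.
Qed.

(** The angles of A and B are at most (pi / 2 + theta1) / 2 < pi / 2 in absolute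
value, and alpha is the cosine of this bound. *)
Lemma alpha_le_cos t : - (pi / 2) <= t <= pi / 2 ->
  alpha mu <= cos ((t + theta1 mu) / 2) /\ alpha mu <= cos ((t + theta2 mu) / 2).
Proof.
move=> /andP[t1 t2]; have /andP[h1 h2] := theta1_bound; have pi0 := pi_gt0 R.
have mono x y : 0 <= x -> x <= y -> y <= pi -> cos y <= cos x :> R.
  move=> x0; rewrite le_eqVlt => /predU1P[->//|xy] ypi; apply/ltW.
  by rewrite ltr_cos// in_itv/=; apply/andP; split=> //; lra.
have key x : `|x| <= (pi / 2 + theta1 mu) / 2 -> alpha mu <= cos x.
  move=> xb; have [x0|/ltW x0] := leP 0 x.
    by rewrite ger0_norm// in xb; apply: mono => //; lra.
  by rewrite -cosN ler0_norm// in xb *; apply: mono => //; lra.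
rewrite /theta2; split; apply: key; rewrite ler_norml; apply/andP; split; lra.
Qed.

Variable lambda : R[i].

Let t := Arg lambda.
Let E := expi ((t + theta1 mu) / 2).
Let F := expi ((t + theta2 mu) / 2).

Lemma expi_sqr (x : R) : expi (x / 2) ^+ 2 = expi x.
Proof. by rewrite expr2 -expiD -splitr. Qed.

Lemma root_mul : E * F = expi t.
Proof. by rewrite /E /F -expiD /theta2; congr expi; field. Qed.

Lemma root_sqr_add : E ^+ 2 + F ^+ 2 = mu%:C * expi t.
Proof.
rewrite /E /F !expi_sqr !expiD -mulrDr mulrC; congr (_ * _).
apply: complex_ext; rewrite /= /theta2 ?cosN ?sinN ?subrr//.
by rewrite cos_theta1; field.
Qed.

Lemma root_sqr_sub : normc (E ^+ 2 - F ^+ 2) = 2 * sin (theta1 mu).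
Proof.
rewrite /E /F !expi_sqr !expiD -mulrBr normcM normc_expi mul1r.
rewrite (_ : _ - _ = 0 +i* (2 * sin (theta1 mu))).
  by rewrite normc_sqrt /normc2/= expr0n/= add0r sqrtr_sqr ger0_norm// mulr_ge0// ltW// sin_theta1_gt0.
apply: complex_ext; rewrite /= /theta2 ?cosN ?sinN ?subrr//; ring.
Qed.

(** With E and F the roots on the unit circle, every product is
|E + E| |E - F| |E + F|, and (E - F) (E + F) has modulus 2 sin theta1. *)
Lemma qrowE j : qrow mu lambda j = 4 * sin (theta1 mu).
Proof.
have nE : normc (E + E) = 2 by rewrite normc_double normc_expi mulr1.
have nF : normc (F + F) = 2 by rewrite normc_double normc_expi mulr1.
have EF : normc (E - F) * normc (E + F) = 2 * sin (theta1 mu).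
  by rewrite -root_sqr_sub subr_sqr normcM.
have FE : normc (F - E) = normc (E - F) by rewrite -normc_opp opprB.
have FE' : normc (F + E) = normc (E + F) by rewrite addrC.
have NE : normc (- E - F) = normc (E + F) by rewrite -opprD normc_opp.
have NF : normc (- F - E) = normc (E + F) by rewrite -opprD normc_opp addrC.
have NEE : normc (- E - E) = 2 by rewrite -opprD normc_opp.
have NFF : normc (- F - F) = 2 by rewrite -opprD normc_opp.
have NEpF : normc (- E + F) = normc (E - F) by rewrite addrC FE.
have NFpE : normc (- F + E) = normc (E - F) by rewrite addrC.
have -> : 4 * sin (theta1 mu) = 2 * (normc (E - F) * normc (E + F)).
  by rewrite EF; ring.
rewrite /qrow big_mkcond !big_ord_recr big_ord0 /zroot -/t -/E -/F {EF}.
(* abstracting the modulus keeps simplification from unfolding it *)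
move: (@normc R) nE nF FE FE' NE NF NEE NFF NEpF NFpE; clearbody E F.
move=> nm nE nF FE FE' NE NF NEE NFF NEpF NFpE.
case: j => [[|[|[|[|//]]]] ij] /=;
  rewrite ?opprK ?(nE, nF, FE, FE', NE, NF, NEE, NFF, NEpF, NFpE); ring.
Qed.

End Angles.

(** * The size of epsilon *)

Section Epsilon.
Variable R : realType.

Lemma frobenius_cst (c : R) (A : 'M[R]_4) : (forall i j, A i j = c) ->
  frobenius A = 4 * `|c|.
Proof.
move=> Ac; rewrite /frobenius.
under eq_bigr do under eq_bigr do rewrite Ac real_normK ?num_real//.
rewrite !sumr_const !card_ord (_ : c ^+ 2 *+ 4 *+ 4 = (4 * c) ^+ 2); last by ring.
by rewrite sqrtr_sqr normrM ger0_norm.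
Qed.

Lemma supabs_ge0 (D : set R) (f : R -> R) : tame f -> 0 <= supabs D f.
Proof.
move=> /tame_bounded [M M0 fM]; rewrite /supabs.
have [->|/set0P [y Dy]] := eqVneq D set0.
  by rewrite image_set0 sup0.
apply: le_trans (normr_ge0 (f y)) _; apply: ub_le_sup; last by exists y.
by exists M => _ [x _ <-].
Qed.

Lemma le_supabs (D : set R) (f : R -> R) x : tame f -> D x -> `|f x| <= supabs D f.
Proof.
move=> /tame_bounded [M M0 fM] Dx; apply: ub_le_sup; last by exists x.
by exists M => _ [y _ <-].
Qed.

Variables (gamma mu s : R) (r u : R -> R).
Hypothesis mu0 : 0 < mu.
Hypothesis mu2 : mu < 2.
Hypothesis rt : tame r.
Hypothesis ut : tame u.
Hypothesis r0 : positive_with_limits r.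

(** The common value of the p_k. *)
Definition ptotal D (lambda : R[i]) : R :=
  m1 mu s r u D lambda + m2 gamma mu s r u D lambda + m3 gamma mu s r u D lambda
  + m4 mu s r D lambda.

Lemma ptotal_ge0 D lambda : 0 <= ptotal D lambda.
Proof.
rewrite /ptotal /m1 /m2 /m3 /m4.
by rewrite !addr_ge0// mulr_ge0 ?invr_ge0 ?powR_ge0 ?normc_ge0// supabs_ge0//;
  [exact: tame_e0|exact: tame_e1|exact: tame_e1'|exact: tame_e2|exact: tame_e3].
Qed.

(** All entries of the matrix coincide. *)
Lemma epsilonE D lambda : epsilon gamma mu s r u D lambda =
  4 * ptotal D lambda / (alpha mu * sin (theta1 mu)).
Proof.
have a0 := alpha_gt0 mu0 mu2; have s0 := sin_theta1_gt0 mu0 mu2.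
rewrite /epsilon (@frobenius_cst (ptotal D lambda / (4 * sin (theta1 mu)))).
  rewrite ger0_norm; last by rewrite divr_ge0 ?ptotal_ge0// mulr_ge0// ltW.
  by field; rewrite !gt_eqF.
by move=> i j; rewrite mxE qrowE.
Qed.

(** Each m_l is O(|lambda|^(-1/2)). *)
Lemma ptotal_decay D : exists2 K : R, 0 <= K & forall lambda, 1 <= normc lambda ->
  ptotal D lambda <= K / Num.sqrt (normc lambda).
Proof.
pose K := supabs D (e0 mu s r u) + (supabs D (e1 gamma mu s r u) + supabs D (e1' mu s r u))
  + supabs D (e2 gamma mu s r u) + supabs D (e3 mu s r).
have S0 := supabs_ge0 D (tame_e0 mu s rt ut r0).
have S1 := supabs_ge0 D (tame_e1 gamma mu s rt ut r0).
have S1' := supabs_ge0 D (tame_e1' mu s rt ut r0).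
have S2 := supabs_ge0 D (tame_e2 gamma mu s rt ut r0).
have S3 := supabs_ge0 D (tame_e3 mu s rt r0).
exists K => [|lambda l1]; first by rewrite !addr_ge0.
have l0 := normc_ge0 lambda.
have e : (normc lambda) `^ (- (1 / 2)) = (Num.sqrt (normc lambda))^-1.
  by rewrite powRN mul1r powR12_sqrt.
have h1 : (normc lambda)^-1 <= (Num.sqrt (normc lambda))^-1.
  by rewrite -e -(powR_inv1 l0); apply: ler_powR => //; lra.
have h2 : (normc lambda) `^ (- (3 / 2)) <= (Num.sqrt (normc lambda))^-1.
  by rewrite -e; apply: ler_powR => //; lra.
rewrite /ptotal /m1 /m2 /m3 /m4 e [leRHS]mulrC !mulrDr.
by rewrite !lerD// ler_wpM2r.
Qed.

Lemma epsilon_small : exists2 C : R, 0 < C & forall lambda, C <= normc lambda ->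
  Num.sqrt 2 * Num.sqrt (epsilon_plus gamma mu s r u lambda ^+ 2
                         + epsilon_minus gamma mu s r u lambda ^+ 2) < 1.
Proof.
have a0 := alpha_gt0 mu0 mu2; have s0 := sin_theta1_gt0 mu0 mu2.
have [K1 K10 KP1] := ptotal_decay [set x | 0 <= x].
have [K2 K20 KP2] := ptotal_decay [set x | x <= 0].
pose G := 16 * (K1 + K2) / (alpha mu * sin (theta1 mu)).
have G0 : 0 <= G by rewrite divr_ge0 ?mulr_ge0 ?addr_ge0// ltW.
(* For |lambda| >= (G + 1)^2 both epsilon are at most G / (4 (G + 1)). *)
exists ((G + 1) ^+ 2) => [|lambda lC]; first by rewrite exprn_gt0//; lra.
have l1 : 1 <= normc lambda by apply: le_trans lC; nra.
have sq : G + 1 <= Num.sqrt (normc lambda).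
  by rewrite -[G + 1]ger0_norm -?sqrtr_sqr ?ler_wsqrtr//; lra.
have bound D K : 0 <= K -> K <= K1 + K2 ->
    ptotal D lambda <= K / Num.sqrt (normc lambda) ->
    0 <= epsilon gamma mu s r u D lambda <= 1 / 4.
  move=> K0 KK pK; rewrite epsilonE divr_ge0 ?mulr_ge0 ?ptotal_ge0 ?(ltW a0) ?(ltW s0)//=.
  rewrite ler_pdivrMr ?mulr_gt0//.
  have : ptotal D lambda * (G + 1) <= K1 + K2.
    apply: le_trans KK; apply: le_trans (ler_wpM2l (ptotal_ge0 D lambda) sq) _.
    by rewrite -ler_pdivlMr// sqrtr_gt0; lra.
  have -> : K1 + K2 = G / 16 * (alpha mu * sin (theta1 mu)).
    by rewrite /G; field; rewrite !gt_eqF.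
  have := mulr_gt0 a0 s0; have := ptotal_ge0 D lambda.
  move: (ptotal _ _) (alpha mu * _) => p as_ p0 as0 h.
  have g1 : 0 < G + 1 by lra.
  rewrite -(ler_pM2r g1); nra.
have KK1 : K1 <= K1 + K2 by rewrite lerDl.
have KK2 : K2 <= K1 + K2 by rewrite lerDr.
have /andP[p0 p1] := bound _ _ K10 KK1 (KP1 _ l1).
have /andP[q0 q1] := bound _ _ K20 KK2 (KP2 _ l1).
rewrite -sqrtrM// -[ltRHS]sqrtr1 ltr_sqrt//.
rewrite /epsilon_plus /epsilon_minus; nra.
Qed.

(** The hypothesis makes both epsilon less than 1, and epsilon = 1 means that the
lower order terms use up half of the spectral gap alpha. *)
Lemma epsilon_lt1 lambda :
  Num.sqrt 2 * Num.sqrt (epsilon_plus gamma mu s r u lambda ^+ 2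
                         + epsilon_minus gamma mu s r u lambda ^+ 2) < 1 ->
  forall D, D = [set x | 0 <= x] \/ D = [set x | x <= 0] ->
  2 * ptotal D lambda / sin (theta1 mu) <= alpha mu / 2.
Proof.
move=> h D DE; have a0 := alpha_gt0 mu0 mu2; have s0 := sin_theta1_gt0 mu0 mu2.
have {h} : 2 * (epsilon_plus gamma mu s r u lambda ^+ 2
                         + epsilon_minus gamma mu s r u lambda ^+ 2) < 1.
  by move: h; rewrite -sqrtrM// -[ltRHS]sqrtr1 ltr_sqrt.
set ep := epsilon_plus _ _ _ _ _ _; set em := epsilon_minus _ _ _ _ _ _ => h.
have : epsilon gamma mu s r u D lambda <= 1.
  case: DE => ->; first by rewrite -/(epsilon_plus _ _ _ _ _ _) -/ep; nra.
  by rewrite -/(epsilon_minus _ _ _ _ _ _) -/em; nra.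
rewrite epsilonE ler_pdivrMr ?mulr_gt0// mul1r => h4.
rewrite ler_pdivrMr//; lra.
Qed.

End Epsilon.

(** * Companion matrices close to the leading part *)

Section Companion.
Variable R : realType.

Definition companion (c : 'I_4 -> R[i]) : 'M[R[i]]_4 :=
  \matrix_(i < 4, j < 4) if val i == 3%N then - c j else (val j == i.+1)%:R.

(** Row i holds the coefficients of the product of the X - Z over the roots Z
other than the i-th one. Applied to (rho, rho', rho'', rho'''), it isolates the
mode of the i-th root. *)
Definition factor_mx (A B : R[i]) : 'M[R[i]]_4 := \matrix_(i < 4, j < 4)
  nth 0 (nth [::] [:: [:: - (A * B ^+ 2); - B ^+ 2; A; 1];
                      [:: - (B * A ^+ 2); - A ^+ 2; B; 1];
                      [:: A * B ^+ 2; - B ^+ 2; - A; 1];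
                      [:: B * A ^+ 2; - A ^+ 2; - B; 1]] i) j.

Lemma sum4 (V : zmodType) (h : 'I_4 -> V) : \sum_i h i = h 0 + h 1 + h 2%:R + h 3%:R.
Proof.
rewrite !big_ord_recr big_ord0/= add0r.
by congr (h _ + h _ + h _ + h _); exact: val_inj.
Qed.

Lemma companion_mulE c (y : 'cV[R[i]]_4) :
  [/\ (companion c *m y) 0 0 = y 1 0, (companion c *m y) 1 0 = y 2%:R 0,
      (companion c *m y) 2%:R 0 = y 3%:R 0 &
      (companion c *m y) 3%:R 0 = - (c 0 * y 0 0 + c 1 * y 1 0 + c 2%:R * y 2%:R 0 + c 3%:R * y 3%:R 0)].
Proof.
by split; rewrite mxE sum4 !mxE /=; ring.
Qed.

Lemma factor_mulE A B (y : 'cV[R[i]]_4) :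
  [/\ (factor_mx A B *m y) 0 0 = - (A * B ^+ 2) * y 0 0 - B ^+ 2 * y 1 0 + A * y 2%:R 0 + y 3%:R 0,
      (factor_mx A B *m y) 1 0 = - (B * A ^+ 2) * y 0 0 - A ^+ 2 * y 1 0 + B * y 2%:R 0 + y 3%:R 0,
      (factor_mx A B *m y) 2%:R 0 = A * B ^+ 2 * y 0 0 - B ^+ 2 * y 1 0 - A * y 2%:R 0 + y 3%:R 0 &
      (factor_mx A B *m y) 3%:R 0 = B * A ^+ 2 * y 0 0 - A ^+ 2 * y 1 0 - B * y 2%:R 0 + y 3%:R 0].
Proof.
by split; rewrite mxE sum4 !mxE /=; ring.
Qed.

Lemma rdotMr (z w g : R[i]) : rdot w (z * w + g) = Re z * normc2 w + rdot w g.
Proof. by rewrite /rdot /normc2 cReD cImD cReM cImM; ring. Qed.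

Lemma rdot_bound (w g : R[i]) : `|rdot w g| <= normc w * normc g.
Proof.
rewrite -ler_sqr ?nnegrE ?mulr_ge0 ?normc_ge0// real_normK ?num_real//.
rewrite exprMn !sqr_normc2 /rdot /normc2.
have := sqr_ge0 (Re w * Im g - Im w * Re g); lra.
Qed.

Lemma normcD_le (z w : R[i]) : normc (z + w) <= normc z + normc w.
Proof.
rewrite -ler_sqr ?nnegrE ?addr_ge0 ?normc_ge0// sqrrD !sqr_normc2.
have := rdot_bound z w; rewrite ler_norml => /andP[_].
by rewrite /rdot /normc2 cReD cImD; lra.
Qed.

Variables (lambda A B : R[i]) (mu a sig al : R).
Hypothesis AB : A * B = lambda.
Hypothesis AABB : A ^+ 2 + B ^+ 2 = lambda * mu%:C.
Hypothesis nA : normc A = a.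
Hypothesis nB : normc B = a.
Hypothesis nD : normc (A ^+ 2 - B ^+ 2) = 2 * a ^+ 2 * sig.
Hypothesis a0 : 0 < a.
Hypothesis sig0 : 0 < sig.
Hypothesis al0 : 0 < al.
Hypothesis ReA : a * al <= Re A.
Hypothesis ReB : a * al <= Re B.

(** The distance from the polynomial with coefficients c to
(X^2 - A^2) (X^2 - B^2) = X^4 - lambda mu X^2 + lambda^2. The coefficient of X^l
is measured in units of a^(3 - l), where a is the modulus of the roots. *)
Definition perturbation (c : 'I_4 -> R[i]) : R :=
  normc (c 0 - lambda ^+ 2) / a ^+ 3 + normc (c 1) / a ^+ 2
  + normc (c 2%:R + lambda * mu%:C) / a + normc (c 3%:R).

Let T := factor_mx A B.

(** Lagrange interpolation, without denominators. *)
Lemma factor_inverse (y : 'cV[R[i]]_4) (D := A ^+ 2 - B ^+ 2) (w := fun i => (T *m y) i 0) :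
  [/\ 2 * A * B * D * y 0 0 = B * (w 0 - w 2%:R) - A * (w 1 - w 3%:R),
      2 * D * y 1 0 = w 0 + w 2%:R - (w 1 + w 3%:R),
      2 * A * B * D * y 2%:R 0 = A ^+ 2 * B * (w 0 - w 2%:R) - B ^+ 2 * A * (w 1 - w 3%:R) &
      2 * D * y 3%:R 0 = A ^+ 2 * (w 0 + w 2%:R) - B ^+ 2 * (w 1 + w 3%:R)].
Proof.
rewrite /w /D /T; have [-> -> -> ->] := factor_mulE A B y.
by split; ring.
Qed.

Let normc2r : normc (2 : R[i]) = 2.
Proof. by rewrite (_ : 2 = (2 : R)%:C) ?normc_real ?ger0_norm// rmorph_nat. Qed.

Let comb_bound (z z' w1 w2 w3 w4 : R[i]) (b : R) : normc z = b -> normc z' = b ->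
  normc (z * (w1 + w3) - z' * (w2 + w4)) <= b * (normc w1 + normc w2 + normc w3 + normc w4).
Proof.
move=> zb zb'; apply: le_trans (normcD_le _ _) _; rewrite normc_opp !normcM zb zb'.
have b0 : 0 <= b by rewrite -zb normc_ge0.
have := ler_wpM2l b0 (normcD_le w1 w3); have := ler_wpM2l b0 (normcD_le w2 w4); lra.
Qed.

Lemma factor_bound (y : 'cV[R[i]]_4)
  (S := normc ((T *m y) 0 0) + normc ((T *m y) 1 0) + normc ((T *m y) 2%:R 0) + normc ((T *m y) 3%:R 0)) :
  [/\ 4 * sig * a ^+ 3 * normc (y 0 0) <= S, 4 * sig * a ^+ 2 * normc (y 1 0) <= S,
      4 * sig * a * normc (y 2%:R 0) <= S & 4 * sig * normc (y 3%:R 0) <= S].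
Proof.
have [y0 y1 y2 y3] := factor_inverse y.
have nn (w : R[i]) := normc_opp w.
split.
- have := comb_bound ((T *m y) 0 0) ((T *m y) 1 0) (- (T *m y) 2%:R 0) (- (T *m y) 3%:R 0) nB nA.
  rewrite -y0 !normcM normc2r nA nB nD !nn -/S => h.
  rewrite -(ler_pM2l a0); apply: le_trans h; rewrite le_eqVlt; apply/orP; left; apply/eqP; ring.
- have := comb_bound ((T *m y) 0 0) ((T *m y) 1 0) ((T *m y) 2%:R 0) ((T *m y) 3%:R 0) (normc1 R) (normc1 R).
  rewrite !mul1r -y1 !normcM normc2r nD -/S => h.
  apply: le_trans h; rewrite le_eqVlt; apply/orP; left; apply/eqP; ring.
- have e1 : normc (A ^+ 2 * B) = a ^+ 3 by rewrite !normcM nA nB; ring.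
  have e2 : normc (B ^+ 2 * A) = a ^+ 3 by rewrite !normcM nA nB; ring.
  have := comb_bound ((T *m y) 0 0) ((T *m y) 1 0) (- (T *m y) 2%:R 0) (- (T *m y) 3%:R 0) e1 e2.
  rewrite -y2 !normcM normc2r nA nB nD !nn -/S => h.
  rewrite -(ler_pM2l (exprn_gt0 3 a0)); apply: le_trans h; rewrite le_eqVlt; apply/orP; left; apply/eqP; ring.
- have e1 : normc (A ^+ 2) = a ^+ 2 by rewrite !normcM nA.
  have e2 : normc (B ^+ 2) = a ^+ 2 by rewrite !normcM nB.
  have := comb_bound ((T *m y) 0 0) ((T *m y) 1 0) ((T *m y) 2%:R 0) ((T *m y) 3%:R 0) e1 e2.
  rewrite -y3 !normcM normc2r nD -/S => h.
  rewrite -(ler_pM2l (exprn_gt0 2 a0)); apply: le_trans h; rewrite le_eqVlt; apply/orP; left; apply/eqP; ring.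
Qed.

Lemma factor_unit : T \in unitmx.
Proof.
rewrite -unitmx_tr -row_free_unit; apply: inj_row_free => v vT.
have Tv : T *m v^T = 0 by rewrite -[T]trmxK -trmx_mul vT trmx0.
have [] := factor_bound v^T; rewrite Tv !mxE normc0 !addr0.
have z (k : R) (w : R[i]) : 0 < k -> k * normc w <= 0 -> w = 0.
  move=> k0; rewrite pmulr_rle0// => h; apply: eq0_normc; apply/eqP.
  by rewrite eq_le h normc_ge0.
have a1 := exprn_gt0 3 a0; have a2 := exprn_gt0 2 a0.
move=> h0 h1 h2 h3; apply/rowP => i; rewrite mxE.
have s4 : 0 < 4 * sig by rewrite mulr_gt0.
have := z _ _ (mulr_gt0 s4 a1) h0; have := z _ _ (mulr_gt0 s4 a2) h1.
have := z _ _ (mulr_gt0 s4 a0) h2; have := z _ _ s4 h3.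
case: i => [[|[|[|[|//]]]] ij] e3 e2 e1 e0.
- by rewrite -[RHS]e0; congr (v _ _); exact: val_inj.
- by rewrite -[RHS]e1; congr (v _ _); exact: val_inj.
- by rewrite -[RHS]e2; congr (v _ _); exact: val_inj.
- by rewrite -[RHS]e3; congr (v _ _); exact: val_inj.
Qed.

(** All modes are driven by the same forcing g. *)
Lemma companion_diag c (y : 'cV[R[i]]_4) (W := T *m y)
  (g := - ((c 0 - lambda ^+ 2) * y 0 0 + c 1 * y 1 0
           + (c 2%:R + lambda * mu%:C) * y 2%:R 0 + c 3%:R * y 3%:R 0)) :
  [/\ (T *m (companion c *m y)) 0 0 = A * W 0 0 + g,
      (T *m (companion c *m y)) 1 0 = B * W 1 0 + g,
      (T *m (companion c *m y)) 2%:R 0 = - A * W 2%:R 0 + g &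
      (T *m (companion c *m y)) 3%:R 0 = - B * W 3%:R 0 + g].
Proof.
have [c0 c1 c2 c3] := companion_mulE c y.
have [-> -> -> ->] := factor_mulE A B (companion c *m y).
rewrite c0 c1 c2 c3 /W /g /T; have [-> -> -> ->] := factor_mulE A B y.
have -> : lambda ^+ 2 = A ^+ 2 * B ^+ 2 by rewrite -AB exprMn.
by rewrite -AABB; split; ring.
Qed.

(** Let S be the sum of the moduli of the modes w_i. The diagonal part contributes
at least a al |w_i|^2 for each i. The forcing satisfies |g| <= a al S / 16, so it
costs at most 2 |g| S, which is half of the diagonal contribution as S^2 is at
most 4 times the sum of the |w_i|^2. *)
Lemma companion_energy c : perturbation c <= a * sig * al / 4 ->
  forall cu cs, 1 <= cu <= 2 -> 1 <= cs <= 2 -> forall y : 'cV[R[i]]_4,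
  a * al / 2 * \sum_i normc2 ((T *m y) i 0) <=
  \sum_i signed sg4 cu cs i * rdot ((T *m y) i 0) ((T *m (companion c *m y)) i 0).
Proof.
move=> pc cu cs /andP[cu1 cu2] /andP[cs1 cs2] y.
rewrite !sum4 /signed /sg4/=.
have [-> -> -> ->] := companion_diag c y.
set g := - (_ + _ + _ + _); rewrite !rdotMr.
have [b0 b1 b2 b3] := factor_bound y.
set w0 := (T *m y) 0 0; set w1 := (T *m y) 1 0.
set w2 := (T *m y) 2%:R 0; set w3 := (T *m y) 3%:R 0.
move: b0 b1 b2 b3; rewrite -/w0 -/w1 -/w2 -/w3.
set S := _ + _ + _ + normc w3 => b0 b1 b2 b3.
have S0 : 0 <= S by rewrite !addr_ge0 ?normc_ge0.
have gS : normc g <= a * al / 16 * S.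
  have h : normc g * (4 * sig) <= perturbation c * S.
    rewrite /g normc_opp /perturbation !mulrDl.
    have t z (k : nat) w : 4 * sig * a ^+ k * normc w <= S ->
        normc (z * w) * (4 * sig) <= normc z / a ^+ k * S.
      move=> h; rewrite normcM -mulrA -mulrA; apply: ler_wpM2l; first exact: normc_ge0.
      rewrite [leRHS]mulrC ler_pdivlMr ?exprn_gt0//; apply: le_trans h.
      by rewrite le_eqVlt; apply/orP; left; apply/eqP; ring.
    have t0 := t (c 0 - lambda ^+ 2) 3%N _ b0.
    have t1 := t (c 1) 2%N _ b1.
    have t2 := t (c 2%:R + lambda * mu%:C) 1%N _ b2.
    have t3 := t (c 3%:R) 0%N (y 3%:R 0); rewrite expr0 mulr1 divr1 in t3.
    have {}t3 := t3 b3; rewrite expr1 in t2.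
    have s4 : 0 <= 4 * sig by rewrite mulr_ge0// ltW.
    apply: le_trans (lerD (lerD (lerD t0 t1) t2) t3).
    rewrite -!mulrDl; apply: ler_wpM2r => //.
    apply: le_trans (normcD_le _ _) _; apply: lerD => //.
    apply: le_trans (normcD_le _ _) _; apply: lerD => //.
    exact: normcD_le.
  have s4 : 0 < 4 * sig by rewrite mulr_gt0.
  rewrite -(ler_pM2r s4); apply: (le_trans h).
  apply: le_trans (ler_wpM2r S0 pc) _.
  by rewrite le_eqVlt; apply/orP; left; apply/eqP; field.
have k0 : 0 < a * al by rewrite mulr_gt0.
move: k0 ReA ReB gS; set k := a * al => k0 rA rB gS.
have r (w : R[i]) : - (normc w * normc g) <= rdot w g <= normc w * normc g.
  by rewrite -ler_norml rdot_bound.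
have n0 (w : R[i]) : 0 <= normc w by exact: normc_ge0.
have G0 := n0 g.
have tu z w : k <= Re z -> k * normc w ^+ 2 - 2 * normc w * normc g <=
    cu * (Re z * normc2 w + rdot w g).
  move=> kz; have /andP[r1 _] := r w; rewrite mulrDr; apply: lerD.
    rewrite sqr_normc2 mulrA ler_wpM2r ?normc2_ge0//.
    by rewrite (le_trans kz)// ler_peMl// (le_trans (ltW k0)).
  rewrite -[2 * normc w * normc g]mulrA.
  apply: (@le_trans _ _ (cu * - (normc w * normc g))).
    by rewrite mulrN lerN2 ler_wpM2r// mulr_ge0.
  by rewrite ler_wpM2l// (le_trans ler01).
have ts z w : k <= Re z -> k * normc w ^+ 2 - 2 * normc w * normc g <=
    - cs * (Re (- z) * normc2 w + rdot w g).
  move=> kz; have /andP[_ r1] := r w.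
  have -> : Re (- z) = - Re z by case: (z).
  rewrite mulrDr; apply: lerD.
    rewrite sqr_normc2 (_ : - cs * _ = cs * Re z * normc2 w); last by ring.
    rewrite ler_wpM2r ?normc2_ge0//.
    by rewrite (le_trans kz)// ler_peMl// (le_trans (ltW k0)).
  rewrite mulNr lerN2 -[2 * normc w * normc g]mulrA.
  apply: (@le_trans _ _ (cs * (normc w * normc g))).
    by rewrite ler_wpM2l// (le_trans ler01).
  by rewrite ler_wpM2r// mulr_ge0.
have h := lerD (lerD (lerD (tu A w0 rA) (tu B w1 rB)) (ts A w2 rA)) (ts B w3 rB).
apply: le_trans h; rewrite -!sqr_normc2.
have SG : S * normc g <= k / 16 * S ^+ 2.
  by rewrite expr2 mulrA [leRHS]mulrC ler_wpM2l.
have S2 : S ^+ 2 <= 4 * (normc w0 ^+ 2 + normc w1 ^+ 2 + normc w2 ^+ 2 + normc w3 ^+ 2).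
  rewrite /S; move: (normc w0) (normc w1) (normc w2) (normc w3) => p0 p1 p2 p3.
  have := sqr_ge0 (p0 - p1); have := sqr_ge0 (p0 - p2); have := sqr_ge0 (p0 - p3).
  have := sqr_ge0 (p1 - p2); have := sqr_ge0 (p1 - p3); have := sqr_ge0 (p2 - p3).
  lra.
have S3 := ler_wpM2l (ltW k0) S2.
have SE : S * normc g = normc w0 * normc g + normc w1 * normc g + normc w2 * normc g + normc w3 * normc g.
  by rewrite /S !mulrDl.
rewrite SE in SG.
lra.
Qed.

End Companion.

(** * Lyapunov's inertia argument *)

Section Lyapunov.
Variables (R : realType) (n : nat) (s : 'I_n -> R) (T M : 'M[R[i]]_n) (tau : R).
Implicit Types x y z : 'cV[R[i]]_n.

Let h x y : R[i] := \sum_i (s i)%:C * (((T *m x) i 0)^*%C * (T *m y) i 0).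

Let hDr x y z : h x (y + z) = h x y + h x z.
Proof.
rewrite /h -big_split/=; apply: eq_bigr => i _; rewrite mulmxDr [(T *m y + T *m z) i 0]mxE; ring.
Qed.

Let hZr x (a : R[i]) y : h x (a *: y) = a * h x y.
Proof.
rewrite /h mulr_sumr; apply: eq_bigr => i _; rewrite -scalemxAr [(a *: (T *m y)) i 0]mxE; ring.
Qed.

Let hC x y : h y x = (h x y)^*%C.
Proof.
rewrite /h rmorph_sum; apply: eq_bigr => i _.
by rewrite !rmorphM /= conjcK oppr0; congr (_ * _); rewrite mulrC.
Qed.

Let hDl x y z : h (y + z) x = h y x + h z x.
Proof. by rewrite hC hDr rmorphD /= -!hC. Qed.

Let hZl x (a : R[i]) y : h (a *: y) x = a^*%C * h y x.
Proof. by rewrite hC hZr rmorphM /= -hC. Qed.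

Let hxx x : h x x = (\sum_i s i * normc2 ((T *m x) i 0))%:C.
Proof.
rewrite /h rmorph_sum; apply: eq_bigr => i _; rewrite rmorphM; congr (_ * _).
by apply: complex_ext; rewrite ?cReM ?cImM /normc2; case: ((T *m x) i 0) => a b /=; ring.
Qed.

Hypothesis growth : forall y, y != 0 ->
  0 < tau * \sum_i s i * rdot ((T *m y) i 0) ((T *m (M *m y)) i 0).

Let growth' y : y != 0 -> 0 < tau * Re (h y (M *m y)).
Proof.
move=> /growth; rewrite /h Re_sum; congr (0 < tau * _); apply: eq_bigr => i _.
rewrite cReM /= mul0r subr0 cReM /rdot; congr (_ * _).
by case: ((T *m y) i 0) => a b /=; ring.
Qed.

Definition herm x : R := \sum_i s i * normc2 ((T *m x) i 0).

Let step y (a : R[i]) z : y != 0 -> 0 < tau * Re a -> M *m y = a *: y + z ->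
  h y z = 0 -> 0 < herm y.
Proof.
move=> y0 a0 My hz; have := growth' y0; rewrite My hDr hz hZr addr0 hxx cReM /= mulr0 subr0.
by rewrite mulrA pmulr_rgt0.
Qed.

(** If M v = a v, then h (v, M v) = a h (v, v), so that h (v, v) has the sign of
Re a. Vectors of a flag behave in the same way once they are made orthogonal to
the previous ones with respect to h: the triangular part of M no longer
contributes. *)
Lemma flag_definite (v1 v2 v3 : 'cV[R[i]]_n) (a1 a2 a3 : R[i]) :
  0 < tau * Re a1 -> 0 < tau * Re a2 -> 0 < tau * Re a3 ->
  M *m v1 = a1 *: v1 -> M *m v2 = a2 *: v2 + v1 -> M *m v3 = a3 *: v3 + v2 ->
  (forall b1 b2 b3 : R[i], b1 *: v1 + b2 *: v2 + b3 *: v3 = 0 ->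
    [/\ b1 = 0, b2 = 0 & b3 = 0]) ->
  exists w1 w2 w3 : 'cV[R[i]]_n, forall b1 b2 b3 : R[i],
    herm (b1 *: w1 + b2 *: w2 + b3 *: w3) <= 0 -> [/\ b1 = 0, b2 = 0 & b3 = 0].
Proof.
move=> p1 p2 p3 M1 M2 M3 free.
have ne b1 b2 b3 : (b1, b2, b3) != 0 :> R[i] * R[i] * R[i] ->
    b1 *: v1 + b2 *: v2 + b3 *: v3 != 0.
  by apply: contra_neq => /free [-> -> ->].
have v10 : v1 != 0.
  apply/eqP => v1E; have e : 1 *: v1 + 0 *: v2 + 0 *: v3 = 0.
    by rewrite v1E scaler0 !scale0r !addr0.
  by have [/eqP] := free _ _ _ e; rewrite oner_eq0.
have H1 : 0 < herm v1.
  
  apply: (step v10 p1 (z := 0)); first by rewrite addr0.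
  by rewrite -(scale0r v1) hZr mul0r.
have nz (x : R) : 0 < x -> x%:C != 0 :> R[i].
  by move=> x0; apply/eqP => /(congr1 (@complex.Re R)) /= xE; rewrite xE ltxx in x0.
pose c := h v1 v2 / (herm v1)%:C.
pose w2 := v2 + (- c) *: v1.
have o12 : h v1 w2 = 0.
  by rewrite /w2 hDr hZr hxx -/(herm v1) mulNr divfK ?nz// subrr.
have o21 : h w2 v1 = 0 by rewrite hC o12 rmorph0.
pose k := 1 + c * a2 - c * a1.
have M2' : M *m w2 = a2 *: w2 + k *: v1.
  rewrite /w2 mulmxDr -scalemxAr M1 M2 /k.
  by apply/colP => i; rewrite !mxE; ring.
have w20 : w2 != 0.
  apply/eqP => w2E; have e : (- c) *: v1 + 1 *: v2 + 0 *: v3 = 0.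
    by rewrite scale0r addr0 scale1r addrC.
  by have [_ /eqP] := free _ _ _ e; rewrite oner_eq0.
have H2 : 0 < herm w2 by apply: (step w20 p2 M2'); rewrite hZr o21 mulr0.
pose e1 := h v1 v3 / (herm v1)%:C; pose e2 := h w2 v3 / (herm w2)%:C.
pose w3 := v3 + (- e1) *: v1 + (- e2) *: w2.
have o13 : h v1 w3 = 0.
  by rewrite /w3 !hDr !hZr o12 mulr0 addr0 hxx -/(herm v1) mulNr divfK ?nz// subrr.
have o23 : h w2 w3 = 0.
  by rewrite /w3 !hDr !hZr o21 mulr0 addr0 hxx -/(herm w2) mulNr divfK ?nz// subrr.
have o31 : h w3 v1 = 0 by rewrite hC o13 rmorph0.
have o32 : h w3 w2 = 0 by rewrite hC o23 rmorph0.
have M3' : M *m w3 = a3 *: w3 +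
    ((a3 * e1 + c - e1 * a1 - e2 * k) *: v1 + (a3 * e2 + 1 - e2 * a2) *: w2).
  rewrite /w3 !mulmxDr -!scalemxAr M1 M3 M2' /w2.
  by apply/colP => i; rewrite !mxE; ring.
have w30 : w3 != 0.
  apply/eqP => w3E; have e : (- e1 + e2 * c) *: v1 + (- e2) *: v2 + 1 *: v3 = 0.
    by rewrite -w3E /w3 /w2; apply/colP => i; rewrite !mxE; ring.
  by have [_ _ /eqP] := free _ _ _ e; rewrite oner_eq0.
have H3 : 0 < herm w3 by apply: (step w30 p3 M3'); rewrite hDr !hZr o31 o32 !mulr0 addr0.
clear M2' M3' w20 w30; clearbody w3; clear e1 e2; clearbody w2; clear k c.
exists v1, w2, w3 => b1 b2 b3.
have -> : herm (b1 *: v1 + b2 *: w2 + b3 *: w3) =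
    normc2 b1 * herm v1 + normc2 b2 * herm w2 + normc2 b3 * herm w3.
  have e (b : R[i]) : b^*%C * b = (normc2 b)%:C.
    by apply: complex_ext; rewrite ?cReM ?cImM /normc2; case: b => a d /=; ring.
  have e1 := e b1; have e2 := e b2; have e3 := e b3.
  apply: complexI; rewrite [LHS](esym (hxx _)) !(hDl, hDr, hZl, hZr) o12 o21 o13 o31 o23 o32.
  rewrite !(mulr0, addr0, add0r) !hxx -!/(herm _).
  move: (normc2 b1) (normc2 b2) (normc2 b3) e1 e2 e3 => n1 n2 n3 e1 e2 e3.
  by rewrite !rmorphD !rmorphM /= -e1 -e2 -e3; ring.
have g (b : R[i]) x : 0 < herm x -> 0 <= normc2 b * herm x.
  by move=> x0; rewrite mulr_ge0 ?normc2_ge0// ltW.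
have gz (b : R[i]) x : 0 < herm x -> normc2 b * herm x <= 0 -> b = 0.
  move=> x0 bx; apply: normc2_eq0; apply/eqP; rewrite eq_le normc2_ge0 andbT.
  by move: bx; rewrite pmulr_lle0.
have g1 := g b1 _ H1; have g2 := g b2 _ H2; have g3 := g b3 _ H3.
move=> le0; split; [apply: (gz _ _ H1)|apply: (gz _ _ H2)|apply: (gz _ _ H3)]; lra.
Qed.

End Lyapunov.

(** * Splitting of the spectrum of a companion matrix *)

Section Splitting.
Variable R : realType.
Implicit Types (c : 'I_4 -> R[i]) (T : 'M[R[i]]_4).

Let coefs c : seq R[i] := [:: c 0; c 1; c 2%:R; c 3%:R; 1].

Let charac c : {poly R[i]} := @Polynomial _ (coefs c) (oner_neq0 _).

Lemma char_poly_companion c : char_poly (companion c) = charac c.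
Proof.
have m : charac c \is monic by apply/monicP.
rewrite -(companionmxK m); congr char_poly.
apply/matrixP => i j; rewrite !mxE; case: (val i == 3%N) => //=; last by rewrite eq_sym.
by congr (- _); case: j => [[|[|[|[|//]]]] ij] /=; congr (c _); exact: val_inj.
Qed.

Lemma char_poly_coefs c (a1 a2 a3 b : R[i]) :
  char_poly (companion c) = ('X - a1%:P) * ('X - a2%:P) * ('X - a3%:P) * ('X - b%:P) ->
  [/\ c 0 = a1 * a2 * a3 * b,
      c 1 = - (a1 * a2 * a3 + a1 * a2 * b + a1 * a3 * b + a2 * a3 * b),
      c 2%:R = a1 * a2 + a1 * a3 + a1 * b + a2 * a3 + a2 * b + a3 * b &
      c 3%:R = - (a1 + a2 + a3 + b)].
Proof.
rewrite char_poly_companion; set q := _ * _ => cq.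
have e : q = ((('X + (- (a1 + a2 + a3 + b))%:P) * 'X
    + (a1 * a2 + a1 * a3 + a1 * b + a2 * a3 + a2 * b + a3 * b)%:P) * 'X
    + (- (a1 * a2 * a3 + a1 * a2 * b + a1 * a3 * b + a2 * a3 * b))%:P) * 'X
    + (a1 * a2 * a3 * b)%:P.
  by rewrite /q !(polyCN, polyCD, polyCM); ring.
have h k : (charac c)`_k = q`_k by rewrite cq.
move: (h 0%N) (h 1%N) (h 2%N) (h 3%N) => /= -> -> -> ->.
by rewrite e !(coefD, coefMX, coefC, coefX)/= !(add0r, addr0).
Qed.

(** The vectors are the divided differences of (1, z, z^2, z^3) at a1, a2, a3.
Unlike eigenvectors, they remain independent when roots coincide. *)
Lemma companion_flag c (a1 a2 a3 b : R[i]) :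
  char_poly (companion c) = ('X - a1%:P) * ('X - a2%:P) * ('X - a3%:P) * ('X - b%:P) ->
  exists v1 v2 v3 : 'cV[R[i]]_4,
  [/\ companion c *m v1 = a1 *: v1, companion c *m v2 = a2 *: v2 + v1,
      companion c *m v3 = a3 *: v3 + v2 &
      forall b1 b2 b3 : R[i], b1 *: v1 + b2 *: v2 + b3 *: v3 = 0 ->
        [/\ b1 = 0, b2 = 0 & b3 = 0]].
Proof.
move=> /char_poly_coefs [c0 c1 c2 c3].
pose col4 (s : seq R[i]) : 'cV[R[i]]_4 := \col_i nth 0 s i.
have ext (v w : 'cV[R[i]]_4) : v 0 0 = w 0 0 -> v 1 0 = w 1 0 -> v 2%:R 0 = w 2%:R 0 ->
    v 3%:R 0 = w 3%:R 0 -> v = w.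
  move=> e0 e1 e2 e3; apply/colP => i.
  have : i \in [:: 0; 1; 2%:R; 3%:R] by case: i => [[|[|[|[|//]]]] ij].
  by rewrite !inE => /or4P[] /eqP ->.
pose v1 := col4 [:: 1; a1; a1 ^+ 2; a1 ^+ 3].
pose v2 := col4 [:: 0; 1; a1 + a2; a1 ^+ 2 + a1 * a2 + a2 ^+ 2].
pose v3 := col4 [:: 0; 0; 1; a1 + a2 + a3].
exists v1, v2, v3.
have [m10 m11 m12 m13] := companion_mulE c v1.
have [m20 m21 m22 m23] := companion_mulE c v2.
have [m30 m31 m32 m33] := companion_mulE c v3.
split.
- by apply: ext; rewrite ?(m10, m11, m12, m13) !mxE /= ?c0 ?c1 ?c2 ?c3; ring.
- by apply: ext; rewrite ?(m20, m21, m22, m23) !mxE /= ?c0 ?c1 ?c2 ?c3; ring.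
- by apply: ext; rewrite ?(m30, m31, m32, m33) !mxE /= ?c0 ?c1 ?c2 ?c3; ring.
- move=> b1 b2 b3 /colP e.
  have := e 0; have := e 1; have := e 2%:R; rewrite !mxE /=.
  rewrite !(mulr0, mulr1, addr0) => e2 e1 e0.
  by move: e1 e2; rewrite e0 !mul0r !add0r => e1; rewrite e1 mul0r add0r.
Qed.

(** Two linear equations in three unknowns. *)
Lemma two_zeros T (w1 w2 w3 : 'cV[R[i]]_4) (i1 i2 : 'I_4) :
  exists b1 b2 b3 : R[i], ~ [/\ b1 = 0, b2 = 0 & b3 = 0] /\
    (T *m (b1 *: w1 + b2 *: w2 + b3 *: w3)) i1 0 = 0 /\
    (T *m (b1 *: w1 + b2 *: w2 + b3 *: w3)) i2 0 = 0.
Proof.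
pose K : 'M[R[i]]_(3, 2) := \matrix_(i < 3, j < 2)
  (T *m nth 0 [:: w1; w2; w3] i) (nth i1 [:: i1; i2] j) 0.
have : kermx K != 0.
  by rewrite kermx_eq0 /row_free neq_ltn (leq_ltn_trans (rank_leq_col K)).
move=> /rowV0Pn [v /sub_kermxP vK v0].
exists (v 0 0), (v 0 1), (v 0 2%:R); split.
  move=> [e0 e1 e2]; move/eqP: v0; apply; apply/rowP => i; rewrite mxE.
  have : i \in [:: 0; 1; 2%:R] by case: i => [[|[|[|//]]] ij].
  by rewrite !inE => /or3P[] /eqP ->.
have addE (X Y : 'cV[R[i]]_4) i : (X + Y) i 0 = X i 0 + Y i 0 by rewrite mxE.
have scaleE (a : R[i]) (X : 'cV[R[i]]_4) i : (a *: X) i 0 = a * X i 0 by rewrite mxE.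
have h (j : 'I_2) : (T *m (v 0 0 *: w1 + v 0 1 *: w2 + v 0 2%:R *: w3)) (nth i1 [:: i1; i2] j) 0 = 0.
  have e : \sum_k v 0 k * K k j = 0.
    by have := congr1 (fun m : 'rV_2 => m 0 j) vK; rewrite [LHS]mxE [RHS]mxE.
  rewrite -[RHS]e !mulmxDr -!scalemxAr !addE !scaleE !big_ord_recr big_ord0/= add0r.
  have KE k : K k j = (T *m nth 0 [:: w1; w2; w3] k) (nth i1 [:: i1; i2] j) 0 by rewrite mxE.
  by rewrite !KE /=; congr (v _ _ * _ + v _ _ * _ + v _ _ * _); exact: val_inj.
by split; [exact: (h 0)|exact: (h 1)].
Qed.

Variables (T : 'M[R[i]]_4) (delta : R) (c : 'I_4 -> R[i]).
Hypothesis Tu : T \in unitmx.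
Hypothesis d0 : 0 < delta.
Hypothesis growth : forall y : 'cV[R[i]]_4, delta * \sum_i normc2 ((T *m y) i 0) <=
  \sum_i signed sg4 1 1 i * rdot ((T *m y) i 0) ((T *m (companion c *m y)) i 0).

Let growth_gt0 (y : 'cV[R[i]]_4) : y != 0 ->
  0 < \sum_i signed sg4 1 1 i * rdot ((T *m y) i 0) ((T *m (companion c *m y)) i 0).
Proof.
move=> y0; apply: lt_le_trans (growth y); rewrite mulr_gt0//.
rewrite lt0r sumr_ge0 ?andbT => [|i _]; last exact: normc2_ge0.
apply: contra_neq y0 => /eqP; rewrite psumr_eq0 => [/allP h|i _]; last exact: normc2_ge0.
apply: (can_inj (mulKmx Tu)); rewrite mulmx0; apply/colP => i; rewrite [RHS]mxE.
by apply: normc2_eq0; apply/eqP; apply: h; rewrite mem_index_enum.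
Qed.

(** Three roots on the side given by tau provide a three-dimensional invariant
space where tau times the form is positive; but that space meets the plane
W_i1 = W_i2 = 0, where it is nonpositive. *)
Let no_three (tau : R) (i1 i2 : 'I_4) (a1 a2 a3 b : R[i]) :
  tau ^+ 2 = 1 ->
  (forall x : 'cV[R[i]]_4, (T *m x) i1 0 = 0 -> (T *m x) i2 0 = 0 ->
     \sum_i tau * signed sg4 1 1 i * normc2 ((T *m x) i 0) <= 0) ->
  char_poly (companion c) = ('X - a1%:P) * ('X - a2%:P) * ('X - a3%:P) * ('X - b%:P) ->
  0 < tau * Re a1 -> 0 < tau * Re a2 -> 0 < tau * Re a3 -> False.
Proof.
move=> tau1 cone cp p1 p2 p3; have [v1 [v2 [v3 [M1 M2 M3 free]]]] := companion_flag cp.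
have g (y : 'cV[R[i]]_4) : y != 0 -> 0 < tau * \sum_i (tau * signed sg4 1 1 i) *
    rdot ((T *m y) i 0) ((T *m (companion c *m y)) i 0).
  move=> /growth_gt0; congr (0 < _); rewrite mulr_sumr; apply: eq_bigr => i _.
  by rewrite !mulrA -expr2 tau1 mul1r.
have [w1 [w2 [w3 def]]] := flag_definite g p1 p2 p3 M1 M2 M3 free.
have [b1 [b2 [b3 [nz [z1 z2]]]]] := two_zeros T w1 w2 w3 i1 i2.
by apply: nz; apply: def; exact: cone.
Qed.

Let root_Re_neq0 (z b1 b2 b3 : R[i]) :
  char_poly (companion c) = ('X - z%:P) * ('X - b1%:P) * ('X - b2%:P) * ('X - b3%:P) ->
  Re z != 0.
Proof.
move=> cp; have [v1 [v2 [v3 [M1 _ _ free]]]] := companion_flag cp.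
have v10 : v1 != 0.
  apply/eqP => v1E; have e : 1 *: v1 + 0 *: v2 + 0 *: v3 = 0.
    by rewrite v1E scaler0 !scale0r !addr0.
  by have [/eqP] := free _ _ _ e; rewrite oner_eq0.
apply/eqP => z0; have := growth_gt0 v10.
have rdot0 (w : R[i]) : rdot w (z * w) = 0.
  by rewrite -[z * w]addr0 rdotMr z0 mul0r add0r /rdot /= !mulr0 addr0.
rewrite big1 ?ltxx// => i _.
by rewrite M1 -scalemxAr [(z *: (T *m v1)) i 0]mxE rdot0 mulr0.
Qed.

Let three_split (p : pred R[i]) (rs : seq R[i]) : size rs = 4%N -> (2 < count p rs)%N ->
  exists a1 a2 a3 b, [/\ perm_eq rs [:: a1; a2; a3; b], p a1, p a2 & p a3].
Proof.
move=> s4; rewrite -size_filter.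
have := permEl (perm_filterC p rs); have := filter_all p rs.
have : (size (seq.filter p rs) + size (seq.filter (predC p) rs) = 4)%N.
  by rewrite !size_filter count_predC.
case: (seq.filter p rs) => [|a1 [|a2 [|a3 l]]] //= sz /and4P[p1 p2 p3 _] pe _.
have {sz} : size (l ++ seq.filter (predC p) rs) = 1%N by rewrite size_cat; lia.
rewrite perm_sym in pe; move: pe.
case: (l ++ _) => [|b [|]]//= pe _.
by exists a1, a2, a3, b.
Qed.

(** There are at most two roots on each side and none on the imaginary axis. *)
Lemma companion_splits22 : splits22 (companion c).
Proof.
have [rs rsE] := closed_field_poly_normal (char_poly (companion c)).
rewrite (monicP (char_poly_monic _)) scale1r in rsE.
have s4 : size rs = 4%N.
  by have := size_char_poly (companion c); rewrite rsE size_prod_XsubC => -[].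
have perm4 a1 a2 a3 b : perm_eq rs [:: a1; a2; a3; b] ->
    char_poly (companion c) = ('X - a1%:P) * ('X - a2%:P) * ('X - a3%:P) * ('X - b%:P).
  by move=> pe; rewrite rsE (perm_big _ pe)/= !big_cons big_nil mulr1 !mulrA.
have le2 (tau : R) i1 i2 : tau ^+ 2 = 1 ->
    (forall x : 'cV[R[i]]_4, (T *m x) i1 0 = 0 -> (T *m x) i2 0 = 0 ->
     \sum_i tau * signed sg4 1 1 i * normc2 ((T *m x) i 0) <= 0) ->
    (count (fun z : R[i] => (0 < tau * Re z)%R) rs <= 2)%N.
  move=> t1 cone; rewrite leqNgt; apply/negP => /(three_split s4).
  move=> [a1 [a2 [a3 [b [pe p1 p2 p3]]]]].
  exact: (no_three t1 cone (perm4 _ _ _ _ pe) p1 p2 p3).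
have zero : normc2 (0 : R[i]) = 0 by rewrite /normc2 /= expr0n addr0.
have pos : (count (fun z : R[i] => (0 < Re z)%R) rs <= 2)%N.
  rewrite (eq_count (a2 := fun z : R[i] => 0 < 1 * Re z)) => [|z]; last by rewrite mul1r.
  apply: (@le2 1 0 1); first by rewrite expr1n.
  move=> x x0 x1; rewrite sum4 /signed /sg4/= x0 x1 zero.
  have := normc2_ge0 ((T *m x) 2%:R 0); have := normc2_ge0 ((T *m x) 3%:R 0); lra.
have neg : (count (fun z : R[i] => (Re z < 0)%R) rs <= 2)%N.
  rewrite (eq_count (a2 := fun z : R[i] => 0 < -1 * Re z)) => [|z]; last by rewrite mulN1r oppr_gt0.
  apply: (@le2 (-1) 2%:R 3%:R); first by rewrite sqrrN expr1n.
  move=> x x0 x1; rewrite sum4 /signed /sg4/= x0 x1 zero.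
  have := normc2_ge0 ((T *m x) 0 0); have := normc2_ge0 ((T *m x) 1 0); lra.
have tot : (count (fun z : R[i] => (0 < Re z)%R) rs + count (fun z : R[i] => (Re z < 0)%R) rs = 4)%N.
  rewrite -s4 -(count_predC (fun z : R[i] => (0 < Re z)%R) rs); congr (_ + _)%N.
  apply: eq_in_count => z zrs /=; rewrite -leNgt lt_neqAle.
  have : exists b1 b2 b3, perm_eq rs [:: z; b1; b2; b3].
    have := perm_to_rem zrs; have : size (rem z rs) = 3%N by rewrite size_rem// s4.
    by case: (rem z rs) => [|b1 [|b2 [|b3 []]]]//= _ pe; exists b1, b2, b3.
  by move=> [b1 [b2 [b3 pe]]]; rewrite (root_Re_neq0 (perm4 _ _ _ _ pe)).
have nat22 (p q : nat) : (p <= 2 -> q <= 2 -> p + q = 4 -> p = 2 /\ q = 2)%N by lia.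
by have [p2 q2] := nat22 _ _ pos neg tot; exists rs.
Qed.

End Splitting.

(** * The coefficients of the Evans system *)

Section EvansCoefficients.
Variables (R : realType) (gamma mu s : R) (r u : R -> R).
Hypothesis rt : tame r.
Hypothesis ut : tame u.
Hypothesis r0 : positive_with_limits r.
Variable lambda : R[i].

Let coef := evans_coef gamma mu s r u lambda.

Let kcap2 : kcap R ^+ 2 = 2.
Proof. by rewrite /kcap sqr_sqrtr. Qed.

Lemma evans_coefE x :
  [/\ coef 0 x = lambda * (e0 mu s r u x)%:C + lambda ^+ 2,
      coef 1 x = (e1 gamma mu s r u x)%:C + lambda * (e1' mu s r u x)%:C,
      coef 2%:R x = (e2 gamma mu s r u x)%:C - lambda * mu%:C &
      coef 3%:R x = (e3 mu s r x)%:C].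
Proof.
have one : (2 / kcap R ^+ 2)%:C = 1 by rewrite kcap2 divff// pnatr_eq0.
split; rewrite /coef /evans_coef /= ?one ?mul1r//.
congr (_%:C); rewrite kcap2 /e3 mulrBr mulrA; congr (_ - _); last by rewrite mulrA.
by field.
Qed.

(** A common shape, which gives continuity, boundedness and limits of all
coefficients at once. *)
Lemma evans_coef_affine j : exists (f g : R -> R) (z w v : R[i]),
  [/\ tame f, tame g & forall x, coef j x = z * (f x)%:C + w * (g x)%:C + v].
Proof.
have j4 : j \in [:: 0; 1; 2%:R; 3%:R] by case: j => [[|[|[|[|//]]]] ij].
have E0 := tame_e0 mu s rt ut r0; have E1 := tame_e1 gamma mu s rt ut r0.
have E1' := tame_e1' mu s rt ut r0; have E2 := tame_e2 gamma mu s rt ut r0.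
have E3 := tame_e3 mu s rt r0.
move: j4; rewrite !inE => /or4P[] /eqP ->.
- exists (e0 mu s r u), (fun=> 0), lambda, 0, (lambda ^+ 2); split => // [|x]; first exact: tame_cst.
  by have [-> _ _ _] := evans_coefE x; rewrite mul0r addr0.
- exists (e1 gamma mu s r u), (e1' mu s r u), 1, lambda, 0; split => // x.
  by have [_ -> _ _] := evans_coefE x; rewrite mul1r addr0.
- exists (e2 gamma mu s r u), (fun=> 0), 1, 0, (- (lambda * mu%:C)); split => // [|x]; first exact: tame_cst.
  by have [_ _ -> _] := evans_coefE x; rewrite mul0r mul1r addr0.
- exists (e3 mu s r), (fun=> 0), 1, 0, 0; split => // [|x]; first exact: tame_cst.
  by have [_ _ _ ->] := evans_coefE x; rewrite mul0r mul1r !addr0.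
Qed.

Lemma cts_bounded_affine (f g : R -> R) (z w v : R[i]) : tame f -> tame g ->
  cts_bounded (fun x => z * (f x)%:C + w * (g x)%:C + v).
Proof.
move=> ft gt; have real (h : R -> R) : tame h -> cts_bounded (fun x => (h x)%:C).
  move=> ht; split; first by have [hc _ _] := ht 0%N.
    by move=> x; exact: cvg_cst.
  by have [M M0 hM] := tame_bounded ht; exists M => x /=; rewrite normr0.
have -> : (fun x => z * (f x)%:C + w * (g x)%:C + v) = fun x => \sum_(i < 3)
    nth 0 [:: z; w; v] i * (nth (fun=> 0) [:: f; g; fun=> 1] i x)%:C.
  by apply/funext => x; rewrite !big_ord_recr big_ord0/= add0r mulr1.
apply: cts_bounded_sum => i; apply: cts_bounded_scale; apply: real.
by case: i => [[|[|[|//]]] i3] //=; exact: tame_cst.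
Qed.

Lemma evans_system_continuous_bounded :
  continuous_bounded (evans_system gamma mu s r u lambda).
Proof.
move=> i j; have [f [g [z [w [v [ft gt fgE]]]]]] := evans_coef_affine j.
rewrite (_ : (fun x => _) = fun x =>
    if val i == 3%N then - coef j x else (val j == i.+1)%:R); last first.
  by apply/funext => x; rewrite mxE.
case: (val i == 3%N).
  rewrite (_ : (fun x => _) = fun x => (- z) * (f x)%:C + (- w) * (g x)%:C + (- v)).
    exact: cts_bounded_affine.
  by apply/funext => x; rewrite fgE !opprD !mulNr.
rewrite (_ : (fun x => _) = fun x => 0 * (0 : R)%:C + 0 * (0 : R)%:C + (val j == i.+1)%:R).
  by apply: (@cts_bounded_affine (fun=> 0) (fun=> 0)); exact: tame_cst.
by apply/funext => x; rewrite !mul0r !add0r.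
Qed.

Lemma evans_coef_limit (F : set_system R) (FF : Filter F) :
  (forall f : R -> R, tame f -> exists l : R, f x @[x --> F] --> l) ->
  exists c : 'I_4 -> R[i], forall j, ccvg F (coef j) (c j).
Proof.
move=> lim; have h j : exists l : R[i], ccvg F (coef j) l.
  have [f [g [z [w [v [ft gt fgE]]]]]] := evans_coef_affine j.
  have real (h : R -> R) : tame h -> exists l : R[i], ccvg F (fun x => (h x)%:C) l.
    by move=> /lim [l hl]; exists l%:C; split => //=; exact: cvg_cst.
  have [l fl] := real _ ft; have [m gm] := real _ gt.
  exists (z * l + w * m + v).
  rewrite (_ : coef j = fun x => 1 * (z * (f x)%:C + w * (g x)%:C) + 1 * v).
    have := ccvg_comb FF 1 1 (ccvg_comb FF z w fl gm) (ccvg_cst FF v).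
    by rewrite !mul1r.
  by apply/funext => x; rewrite !mul1r fgE.
by have [c cP] := choice h; exists c.
Qed.

End EvansCoefficients.

(** * The Evans function *)

Section EvansFunction.
Variables (R : realType) (gamma mu s : R) (r u : R -> R).
Hypothesis mu0 : 0 < mu.
Hypothesis mu2 : mu < 2.
Hypothesis rt : tame r.
Hypothesis ut : tame u.
Hypothesis r0 : positive_with_limits r.
Variable lambda : R[i].
Hypothesis lambda_neq0 : lambda != 0.
Hypothesis Re_lambda : 0 <= Re lambda.
Hypothesis small : forall D, D = [set x | 0 <= x] \/ D = [set x | x <= 0] ->
  2 * ptotal gamma mu s r u D lambda / sin (theta1 mu) <= alpha mu / 2.

Let n := normc lambda.
Let a := Num.sqrt n.
Let A := a%:C * expi ((Arg lambda + theta1 mu) / 2).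
Let B := a%:C * expi ((Arg lambda + theta2 mu) / 2).
Let sig := sin (theta1 mu).
Let al := alpha mu.

Let n_gt0 : 0 < n. Proof. exact: normc_gt0. Qed.
Let a_gt0 : 0 < a. Proof. by rewrite sqrtr_gt0. Qed.
Let a2 : a ^+ 2 = n. Proof. by rewrite sqr_sqrtr// ltW. Qed.
Let sig_gt0 : 0 < sig. Proof. exact: sin_theta1_gt0. Qed.
Let al_gt0 : 0 < al. Proof. exact: alpha_gt0. Qed.

Let lambdaE : lambda = (a ^+ 2)%:C * expi (Arg lambda).
Proof. by rewrite a2; have [] := Arg_spec lambda_neq0. Qed.

Let AB : A * B = lambda.
Proof.
rewrite [RHS]lambdaE -(root_mul mu lambda) /A /B expr2 rmorphM; ring.
Qed.

Let AABB : A ^+ 2 + B ^+ 2 = lambda * mu%:C.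
Proof.
rewrite [in RHS]lambdaE -mulrA [expi _ * _]mulrC -(root_sqr_add mu0 mu2).
by rewrite /A /B !expr2 rmorphM; ring.
Qed.

Let normc_scaled (t : R) : normc (a%:C * expi t) = a.
Proof. by rewrite normcM normc_expi mulr1 normc_real gtr0_norm. Qed.

Let nD : normc (A ^+ 2 - B ^+ 2) = 2 * a ^+ 2 * sig.
Proof.
rewrite /A /B !exprMn -mulrBr normcM (root_sqr_sub mu0 mu2) -rmorphXn normc_real.
by rewrite ger0_norm ?sqr_ge0// mulrA [a ^+ 2 * 2]mulrC.
Qed.

Let angle : - (pi / 2) <= Arg lambda <= pi / 2.
Proof.
apply: cos_ge0_le_pihalf; first by have [] := Arg_spec lambda_neq0.
by move: Re_lambda; rewrite Arg_cos// pmulr_rge0.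
Qed.

Let Re_scaled (t : R) : Re (a%:C * expi t) = a * cos t.
Proof. by rewrite cReM /= mul0r subr0. Qed.

Let ReA : a * al <= Re A.
Proof. by rewrite Re_scaled ler_pM2l//; exact: (alpha_le_cos mu0 mu2 angle).1. Qed.

Let ReB : a * al <= Re B.
Proof. by rewrite Re_scaled ler_pM2l//; exact: (alpha_le_cos mu0 mu2 angle).2. Qed.

Let coef x : 'I_4 -> R[i] := (evans_coef gamma mu s r u lambda)^~ x.

(** The m_l measure the lower order terms after scaling x by a. *)
Let perturbation_ptotal D x : D x ->
  perturbation lambda mu a (coef x) <= a * ptotal gamma mu s r u D lambda.
Proof.
move=> Dx; have [c0 c1 c2 c3] := evans_coefE gamma mu s r u lambda x.
have h0 := le_supabs (tame_e0 mu s rt ut r0) Dx.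
have h1 := le_supabs (tame_e1 gamma mu s rt ut r0) Dx.
have h1' := le_supabs (tame_e1' mu s rt ut r0) Dx.
have h2 := le_supabs (tame_e2 gamma mu s rt ut r0) Dx.
have h3 := le_supabs (tame_e3 mu s rt r0) Dx.
have an0 : a != 0 by rewrite gt_eqF.
have pw : n `^ (- (1 / 2)) = a^-1.
  by rewrite powRN mul1r powR12_sqrt// ltW.
have pw3 : n `^ (- (3 / 2)) = a ^- 3.
  rewrite powRN -a2 -(@powR_mulrn _ a 2 (ltW a_gt0)) -powRrM.
  by rewrite (_ : 2%:R * (3 / 2) = 3%:R) ?powR_mulrn ?(ltW a_gt0)//; field.
rewrite /perturbation /coef c0 c1 c2 c3 addrK subrK /ptotal /m1 /m2 /m3 /m4 -/n pw pw3 -a2.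
rewrite !mulrDr; apply: lerD; last first.
  by rewrite normc_real mulrA divff// mul1r.
apply: lerD; last first.
  rewrite normc_real [leRHS]mulrA (_ : a * (a ^+ 2)^-1 = a^-1); last by field.
  by rewrite mulrC ler_pM2l// invr_gt0.
apply: lerD.
  rewrite normcM normc_real -/n -a2 [leRHS]mulrA (_ : a * (a ^+ 2)^-1 = a^-1); last by field.
  rewrite mulrC mulrA (_ : (a ^+ 3)^-1 * a ^+ 2 = a^-1); last by field.
  by rewrite ler_pM2l// invr_gt0.
have le : normc ((e1 gamma mu s r u x)%:C + lambda * (e1' mu s r u x)%:C) <=
    `|e1 gamma mu s r u x| + a ^+ 2 * `|e1' mu s r u x|.
  by apply: le_trans (normcD_le _ _) _; rewrite normcM !normc_real -/n a2.
rewrite ler_pdivrMr ?exprn_gt0//; apply: (le_trans le).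
rewrite mulrDl; apply: lerD.
  by rewrite [leRHS](_ : _ = supabs D (e1 gamma mu s r u))//; field.
rewrite [leRHS](_ : _ = a ^+ 2 * supabs D (e1' mu s r u)); last by field.
by rewrite ler_pM2l// exprn_gt0.
Qed.

Let perturbation_small x : perturbation lambda mu a (coef x) <= a * sig * al / 4.
Proof.
have bound D : D = [set x | 0 <= x] \/ D = [set x | x <= 0] ->
    a * ptotal gamma mu s r u D lambda <= a * sig * al / 4.
  move=> /small; rewrite ler_pdivrMr// => h.
  rewrite -!mulrA ler_pM2l// -/sig -/al in h *; lra.
have [x0|x0] := leP 0 x.
  exact: le_trans (@perturbation_ptotal [set x | 0 <= x] _ x0) (bound _ (or_introl erefl)).
exact: le_trans (@perturbation_ptotal [set x | x <= 0] _ (ltW x0)) (bound _ (or_intror erefl)).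
Qed.

Let nA : normc A = a. Proof. exact: normc_scaled. Qed.
Let nB : normc B = a. Proof. exact: normc_scaled. Qed.

Let T := factor_mx A B.

Let energy c : perturbation lambda mu a c <= a * sig * al / 4 ->
  forall cu cs, 1 <= cu <= 2 -> 1 <= cs <= 2 -> forall y : 'cV[R[i]]_4,
  a * al / 2 * \sum_i normc2 ((T *m y) i 0) <=
  \sum_i signed sg4 cu cs i * rdot ((T *m y) i 0) ((T *m (companion c *m y)) i 0).
Proof. exact: companion_energy. Qed.

Let delta_gt0 : 0 < a * al / 2. Proof. by rewrite divr_gt0// mulr_gt0. Qed.

Let Tu : T \in unitmx. Proof. exact: (factor_unit nA nB nD). Qed.

Let growth : cenergy_growth T sg4 (evans_system gamma mu s r u lambda) (a * al / 2).
Proof. by move=> cu cs cu12 cs12 x y; exact: (energy (perturbation_small x)). Qed.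

(** The smallness of the perturbation passes to the limit. *)
Let limit_splits (F : set_system R) (FF : ProperFilter F) :
  (forall f : R -> R, tame f -> exists l : R, f x @[x --> F] --> l) ->
  limit_splits22 (evans_system gamma mu s r u lambda) F.
Proof.
move=> lim; have [c cP] := evans_coef_limit gamma mu s rt ut r0 lambda _ lim.
exists (companion c); split=> [i j|].
  rewrite mxE (_ : (fun x => _) = fun x =>
    if val i == 3%N then - coef x j else (val j == i.+1)%:R); last first.
    by apply/funext => x; rewrite mxE.
  case: (val i == 3%N); last exact: ccvg_cst.
  rewrite -mulN1r (_ : (fun x => _) = fun x => -1 * coef x j).
    by apply: ccvgM; [exact: ccvg_cst|exact: cP].
  by apply/funext => x; rewrite mulN1r.
have pc : perturbation lambda mu a c <= a * sig * al / 4.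
  have cn (f : R -> R[i]) l : ccvg F f l -> normc (f x) @[x --> F] --> normc l.
    move=> [fr fi]; rewrite normc_sqrt; under eq_cvg do rewrite normc_sqrt.
    apply: (@cvg_comp _ _ _ _ Num.sqrt _ _ _ _ (@sqrt_continuous R _)).
    by rewrite /normc2; apply: cvgD; under eq_cvg do rewrite expr2; rewrite expr2; exact: cvgM.
  have cadd (f : R -> R[i]) l (z : R[i]) : ccvg F f l -> ccvg F (fun x => f x + z) (l + z).
    move=> fl; rewrite -[l]mul1r -[z]mul1r.
    rewrite (_ : (fun x => _) = fun x => 1 * f x + 1 * z).
      by apply: ccvg_comb => //; exact: ccvg_cst.
    by apply/funext => x; rewrite !mul1r.
  have cv : perturbation lambda mu a (coef x) @[x --> F] --> perturbation lambda mu a c.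
    rewrite /perturbation; apply: cvgD; last exact/cn/cP.
    apply: cvgD; last by apply: cvgM; [exact/cn/cadd/cP|exact: cvg_cst].
    apply: cvgD; last by apply: cvgM; [exact/cn/cP|exact: cvg_cst].
    by apply: cvgM; [exact/cn/cadd/cP|exact: cvg_cst].
  rewrite -(cvg_lim _ cv)//; apply: limr_le; first by apply/cvg_ex; exists (perturbation lambda mu a c).
  by apply: nearW => x; exact: perturbation_small.
have one : 1 <= (1 : R) <= 2 by rewrite lexx ler1n.
exact: (companion_splits22 Tu delta_gt0 (energy pc one one)).
Qed.

Lemma evans_nonzero : evans_defined_nonzero (evans_system gamma mu s r u lambda).
Proof.
have cb := evans_system_continuous_bounded gamma mu s rt ut r0 lambda.
split.
  have [Y1m [Y2m bm]] := decaying_basis_minus Tu delta_gt0 cb growth.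
  have [Y1p [Y2p bp]] := decaying_basis_plus Tu delta_gt0 cb growth.
  exists (\det (row_mx (row_mx (Y1m 0) (Y2m 0)) (row_mx (Y1p 0) (Y2p 0)) : 'M[R[i]]_4)).
  split.
  - by apply: limit_splits => f /(_ 0%N) [_ []].
  - by apply: limit_splits => f /(_ 0%N) [_ []].
  - by exists Y1m, Y2m, Y1p, Y2p.
move=> e [_ _ [Y1m [Y2m [Y1p [Y2p [bm bp ->]]]]]].
exact: (evans_det_neq0 Tu delta_gt0 cb growth bm bp).
Qed.

End EvansFunction.

Theorem lemma3p3 (R : realType) (gamma mu s : R) (r u : R -> R)
    (hgamma : 1 <= gamma) (hmu : 0 < mu)
    (hprofile : traveling_wave gamma mu s r u) (hmu2 : mu < 2) :
  let eps_small (lambda : R[i]) : Prop :=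
    Num.sqrt 2 * Num.sqrt (epsilon_plus gamma mu s r u lambda ^+ 2
                           + epsilon_minus gamma mu s r u lambda ^+ 2) < 1 in
  let region (C : R) (lambda : R[i]) : Prop :=
    0 <= complex.Re lambda /\ C <= normc lambda in
  (exists2 C : R, 0 < C & forall lambda, region C lambda -> eps_small lambda)
  /\
  (forall C : R, 0 < C ->
     (forall lambda, region C lambda -> eps_small lambda) ->
     forall lambda, region C lambda ->
       evans_defined_nonzero (evans_system gamma mu s r u lambda)).
Proof.
have [rt ut r0] := profile_tame hprofile.
move=> eps_small region; split.
  have [C C0 CP] := epsilon_small gamma s hmu hmu2 rt ut r0.
  by exists C => // lambda [_ lC]; exact: CP.
move=> C C0 CP lambda lreg; have [Rel lC] := lreg.
have l0 : lambda != 0.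
  by apply/eqP => lE; move: lC; rewrite lE normc0 leNgt C0.
apply: evans_nonzero => // D DE.
exact: (epsilon_lt1 hmu hmu2 rt ut r0 (CP _ lreg) DE).
Qed.
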